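(* Consider the Gaussian state-dependent multiple-access channel with cooperating encoders described in the context, $Y=X_1+X_2+S_0+S_1+S_2+Z$, with independent states $S_j\sim\mathcal N(0,Q_j)$, $j=0,1,2$, noise $Z\sim\mathcal N(0,N)$, and power constraints $P_1,P_2$, where $P_1,P_2,Q_0,Q_1,Q_2,N>0$. Write $\overline{x}=1-x$ and, for $i=1,2$, $Q_i'=(\sqrt{Q_i}-\sqrt{\overline{\eta_i}P_i})^2$. Then the following rate region is achievable: the union, over all $\alpha_1,\alpha_2\in[0,1]$ and all $\eta_1,\eta_2$ with $1-\min\{1,Q_i/P_i\}\le\eta_i\le1$ ($i=1,2$), of the sets of pairs $(R_1,R_2)$ with $R_1\ge0$, $R_2\ge0$ and $$R_1+R_2\le\frac12\log_2\left\{\left(1+\frac{(\sqrt{\alpha_1\eta_1P_1}+\sqrt{\alpha_2\eta_2P_2})^2}{\overline{\alpha_1}\eta_1P_1+\overline{\alpha_2}\eta_2P_2+Q_1'+Q_2'+N}\right)\left(1+\frac{\overline{\alpha_1}\eta_1P_1}{\overline{\alpha_2}\eta_2P_2+Q_2'+N}\right)\left(1+\frac{\overline{\alpha_2}\eta_2P_2}{\overline{\alpha_1}\eta_1P_1+Q_1'+N}\right)\right\}.$$ That is, every such pair belongs to the capacity region (the closure of the set of achievable rate pairs).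
   Context: Channel model. At each time $t=1,\dots,n$ the output is $Y_t=X_{1,t}+X_{2,t}+S_{0,t}+S_{1,t}+S_{2,t}+Z_t$, where all $S_{j,t}\sim\mathcal N(0,Q_j)$ ($j=0,1,2$) and $Z_t\sim\mathcal N(0,N)$ are mutually independent, over $j$ and $t$. Encoder 1 knows $(S_0^n,S_1^n)$ non-causally and encoder 2 knows $(S_0^n,S_2^n)$ non-causally. Codes. Encoder $i\in\{1,2\}$ has a message $W_i$ uniform on $\mathcal W_i=\{1,\dots,2^{nR_i}\}$ (rounded down to an integer if necessary); $W_1,W_2$, states and noise are independent. A length-$n$ code consists of (measurable) encoding functions giving $X_{1,j}=f_{1,j}(W_1,S_0^n,S_1^n,X_2^{j-1})$ and $X_{2,j}=f_{2,j}(W_2,S_0^n,S_2^n,X_1^{j-1})$ in $\mathbb R$ for $j=1,\dots,n$ (each encoder observes the other's past real-valued transmitted symbols noiselessly and strictly causally: ''cooperating encoders''), satisfying the average power constraints $\frac1n\sum_{j=1}^n\mathbb E[X_{i,j}^2]\le P_i$, $i=1,2$, together with a (measurable) decoding function $g:\mathbb R^n\to\mathcal W_1\times\mathcal W_2$, $(\hat W_1,\hat W_2)=g(Y^n)$. A pair $(R_1,R_2)$ is achievable if there is a sequence of such codes with average error probability $\Pr\{(\hat W_1,\hat W_2)\neq(W_1,W_2)\}\to0$ as $n\to\infty$; the capacity region is the closure of the set of achievable pairs. *)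

(* Defs.v *)
From HB Require Import structures.
From mathcomp Require Import all_boot all_order all_algebra finmap.
From mathcomp Require Import all_classical all_reals all_analysis.

Set Implicit Arguments.
Unset Strict Implicit.
Unset Printing Implicit Defensive.

Import Order.TTheory GRing.Theory Num.Theory.
Import numFieldNormedType.Exports.

Local Open Scope classical_set_scope.
Local Open Scope ring_scope.

Section ordinal_measurable.
Variable n : nat.

Definition ord_measurable : set (set 'I_n.+1) := setT.

Let ord_measurable0 : ord_measurable set0. Proof. by []. Qed.

Let ord_measurableC A : ord_measurable A -> ord_measurable (~` A).
Proof. by []. Qed.

Let ord_measurableU (F : (set 'I_n.+1)^nat) :
  (forall i, ord_measurable (F i)) -> ord_measurable (\bigcup_i F i).
Proof. by []. Qed.

HB.instance Definition _ := isPointed.Build 'I_n.+1 ord0.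

HB.instance Definition _ := @isMeasurable.Build default_measure_display 'I_n.+1
  ord_measurable ord_measurable0 ord_measurableC ord_measurableU.

End ordinal_measurable.

(* The default argument [\d_ord0] of [mnormalize] is irrelevant: the counting
   measure of ['I_m.+1] is finite and nonzero. *)
Definition uniform_ord (R : realType) (m : nat) : probability 'I_m.+1 R :=
  mnormalize (@counting 'I_m.+1 R) \d_ord0.

Lemma uniform_ord1 (R : realType) (m : nat) (i : 'I_m.+1) :
  uniform_ord R m [set i] = (m.+1%:R^-1)%:E.
Proof.
have finI (A : set 'I_m.+1) : finite_set A by exact: finite_finset.
have countE (A : set 'I_m.+1) : counting A = (#|` fset_set A |)%:R%:E :> \bar R.
  by rewrite /counting asboolT.
have cardT : #|` fset_set [set: 'I_m.+1]| = m.+1.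
  rewrite (_ : fset_set _ = [fset x in 'I_m.+1]%fset); last first.
    by apply/fsetP => x; rewrite in_fset_set// !inE/= mem_set.
  by rewrite card_imfset//= -cardE card_ord.
rewrite /= /mnormalize/= !countE cardT eqe pnatr_eq0/= countE fset_set1.
by rewrite cardfs1 mul1e.
Qed.

Section iid.
Context d (T : measurableType d) (R : realType).

Definition cons_pair n (p : T * n.-tuple T) : n.+1.-tuple T :=
  [tuple of p.1 :: p.2].

Lemma measurable_cons_pair n :
  measurable_fun [set: T * n.-tuple T] (@cons_pair n).
Proof. exact: measurable_cons. Qed.

HB.instance Definition _ n :=
  isMeasurableFun.Build _ _ _ _ (@cons_pair n) (@measurable_cons_pair n).

(* The n-fold product measure P x ... x P, that is, the law of n independent
   variables of law P. *)
Fixpoint iid (P : probability T R) (n : nat) : probability (n.-tuple T) R :=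
  match n with
  | 0 => \d_([tuple] : 0.-tuple T)
  | m.+1 => distribution (P \x iid P m)%E (@cons_pair m)
  end.

Lemma iid_box (P : probability T R) (n : nat) (A : 'I_n -> set T) :
  (forall i, measurable (A i)) ->
  iid P n [set t | forall i, A i (tnth t i)] = (\prod_(i < n) P (A i))%E.
Proof.
elim: n A => [|n IH] A mA /=.
  by rewrite big_ord0 diracE mem_set// => -[].
rewrite /distribution /pushforward big_ord_recl/= -IH//.
rewrite -product_measure1E//; last first.
  rewrite [X in measurable X](_ : _ = \bigcap_(i in [set: 'I_n])
      (fun t : n.-tuple T => tnth t i) @^-1` A (lift ord0 i)).
    apply: fin_bigcap_measurable => [|i _]; first exact: finite_finset.
    by rewrite -[X in measurable X]setTI; exact: measurable_tnth.
  by apply/seteqP; split => t /= At i; [move=> _|]; exact: At.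
congr ((P \x iid P n)%E _); apply/seteqP; split => -[x t]/=.
  move=> H; split => [|i]; first exact: (H ord0).
  by have := H (lift ord0 i); rewrite tnthS.
by move=> [Ax At] i; case: (unliftP ord0 i) => [j ->|->//]; rewrite tnthS.
Qed.

End iid.

Section gaussian_mac.
Context {R : realType}.

Definition log2 (x : R) : R := ln x / ln 2.

Section gaussian.
Variable v : R.

(* The law N(0, v): [normal_prob m s] is parametrized by the standard deviation
   [s]. It is a measure on [measurableTypeR R], an alias of [R] with the same
   measurable sets but another display; the instances below restate it on [R]. *)
Definition gaussian : set R -> \bar R := normal_prob 0 (Num.sqrt v).

Let gaussian0 : gaussian set0 = 0%E.
Proof. exact: (measure0 (normal_prob 0 (Num.sqrt v))). Qed.

Let gaussian_ge0 A : (0 <= gaussian A)%E.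
Proof. exact: (measure_ge0 (normal_prob 0 (Num.sqrt v))). Qed.

Let gaussian_sigma_additive : semi_sigma_additive gaussian.
Proof.
exact: (@measure_semi_sigma_additive _ _ _ (normal_prob 0 (Num.sqrt v))).
Qed.

HB.instance Definition _ := isMeasure.Build _ _ _ gaussian
  gaussian0 gaussian_ge0 gaussian_sigma_additive.

Let gaussian_setT : gaussian [set: R] = 1%E.
Proof. exact: (probability_setT (normal_prob 0 (Num.sqrt v))). Qed.

HB.instance Definition _ :=
  @Measure_isProbability.Build _ _ R gaussian gaussian_setT.

End gaussian.

(* Messages are ['I_m1.+1] and ['I_m2.+1]; time is counted from 0, so that the
   symbol sent at time j depends on the j symbols sent before by the other
   encoder. Only the encoding functions with j < n are used. *)
Record code (n m1 m2 : nat) := Code {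
  enc1 : forall j,
    {mfun ('I_m1.+1 * n.-tuple R * n.-tuple R * j.-tuple R)%type >-> R} ;
  enc2 : forall j,
    {mfun ('I_m2.+1 * n.-tuple R * n.-tuple R * j.-tuple R)%type >-> R} ;
  dec : {mfun n.-tuple R >-> ('I_m1.+1 * 'I_m2.+1)%type} }.

Section fixed_code.
Variables (n m1 m2 : nat).

(* ((W1, W2), (S0^n, S1^n, S2^n, Z^n)) *)
Local Notation sample := (('I_m1.+1 * 'I_m2.+1) *
  (n.-tuple R * n.-tuple R * n.-tuple R * n.-tuple R))%type.

(* Mutual independence of the messages, the states and the noise, over all times,
   is expressed by the product measure. *)
Definition channel_law (Q0 Q1 Q2 N : R) : probability sample R :=
  ((uniform_ord R m1 \x uniform_ord R m2) \x
   (iid (gaussian Q0) n \x iid (gaussian Q1) n \x iid (gaussian Q2) n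
    \x iid (gaussian N) n))%E.

Definition W1 (w : sample) := w.1.1.
Definition W2 (w : sample) := w.1.2.
Definition S0 (w : sample) := w.2.1.1.1.
Definition S1 (w : sample) := w.2.1.1.2.
Definition S2 (w : sample) := w.2.1.2.
Definition Z (w : sample) := w.2.2.

Variable c : code n m1 m2.

(* The symbols sent by both encoders before time k. *)
Fixpoint inputs (w : sample) (k : nat) : k.-tuple R * k.-tuple R :=
  match k with
  | 0 => ([tuple], [tuple])
  | j.+1 =>
      let x := inputs w j in
      ([tuple of rcons x.1 (enc1 c j (W1 w, S0 w, S1 w, x.2))],
       [tuple of rcons x.2 (enc2 c j (W2 w, S0 w, S2 w, x.1))])
  end.

Definition X1 (w : sample) : n.-tuple R := (inputs w n).1.
Definition X2 (w : sample) : n.-tuple R := (inputs w n).2.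

Definition Y (w : sample) : n.-tuple R :=
  [tuple tnth (X1 w) t + tnth (X2 w) t
         + tnth (S0 w) t + tnth (S1 w) t + tnth (S2 w) t + tnth (Z w) t | t < n].

Section fixed_law.
Variable P : probability sample R.

Definition power1 : \bar R :=
  ((n%:R^-1)%:E * \sum_(j < n) 'E_P[fun w => (tnth (X1 w) j ^+ 2)%R])%E.

Definition power2 : \bar R :=
  ((n%:R^-1)%:E * \sum_(j < n) 'E_P[fun w => (tnth (X2 w) j ^+ 2)%R])%E.

Definition error_prob : \bar R := P [set w | dec c (Y w) <> (W1 w, W2 w)].

End fixed_law.
End fixed_code.

Definition num_messages (n : nat) (r : R) : nat := Num.truncn (2 `^ (n%:R * r)).

Lemma num_messages_gt0 (n : nat) (r : R) : 0 <= r -> (0 < num_messages n r)%N.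
Proof.
move=> r0; rewrite /num_messages truncn_gt0 -[leLHS](powRr0 2).
by rewrite ler_powR ?ler1n// mulr_ge0.
Qed.

(* As rates are nonnegative, [(num_messages n r).-1.+1 = num_messages n r]. *)
Definition rate_code (n : nat) (r1 r2 : R) :=
  code n (num_messages n r1).-1 (num_messages n r2).-1.

Definition achievable (P1 P2 Q0 Q1 Q2 N : R) (r : R * R) : Prop :=
  0 <= r.1 /\ 0 <= r.2 /\
  exists c : forall n, rate_code n r.1 r.2,
    (forall n, (0 < n)%N ->
       (power1 (c n) (channel_law _ _ _ Q0 Q1 Q2 N) <= P1%:E)%E /\
       (power2 (c n) (channel_law _ _ _ Q0 Q1 Q2 N) <= P2%:E)%E) /\
    error_prob (c n) (channel_law _ _ _ Q0 Q1 Q2 N) @[n --> \oo] --> 0%E.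

Definition capacity_region (P1 P2 Q0 Q1 Q2 N : R) : set (R * R) :=
  closure [set r | achievable P1 P2 Q0 Q1 Q2 N r].

(* Q_i': the state power left when an encoder of power P spends (1 - eta) P on
   partial cancellation of its own state of power Q. *)
Definition residual (Q P eta : R) : R :=
  (Num.sqrt Q - Num.sqrt ((1 - eta) * P)) ^+ 2.

Definition sum_rate_bound (P1 P2 Q1 Q2 N alpha1 alpha2 eta1 eta2 : R) : R :=
  let Q1' := residual Q1 P1 eta1 in
  let Q2' := residual Q2 P2 eta2 in
  2^-1 * log2
   ((1 + (Num.sqrt (alpha1 * eta1 * P1) + Num.sqrt (alpha2 * eta2 * P2)) ^+ 2 /
         ((1 - alpha1) * eta1 * P1 + (1 - alpha2) * eta2 * P2 + Q1' + Q2' + N)) *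
    (1 + (1 - alpha1) * eta1 * P1 / ((1 - alpha2) * eta2 * P2 + Q2' + N)) *
    (1 + (1 - alpha2) * eta2 * P2 / ((1 - alpha1) * eta1 * P1 + Q1' + N))).

Definition rate_region (P1 P2 Q1 Q2 N : R) : set (R * R) :=
  [set r | exists alpha1 alpha2 eta1 eta2 : R,
    [/\ 0 <= alpha1 <= 1, 0 <= alpha2 <= 1,
        1 - Num.min 1 (Q1 / P1) <= eta1 <= 1 &
        1 - Num.min 1 (Q2 / P2) <= eta2 <= 1] /\
    [/\ 0 <= r.1, 0 <= r.2 &
        r.1 + r.2 <= sum_rate_bound P1 P2 Q1 Q2 N alpha1 alpha2 eta1 eta2]].

End gaussian_mac.

(* Main.v *)
(* The encoders observe each other's past inputs as exact real numbers, so one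
   symbol of arbitrarily small power suffices for each to reveal its message and
   a quantization of its own state; the quantization residue of a state is
   cancelled by the encoder that knows it. From time 1 on, the two encoders thus
   act as a single transmitter of power (sqrt P1 + sqrt P2)^2 that knows the
   remaining state s, and dirty-paper coding achieves every sum rate below
   1/2 log2 (1 + (sqrt P1 + sqrt P2)^2 / N), which dominates the claimed bound.

   The dirty-paper code of length m is a random colouring of a fine cubic grid,
   in which every message has a colour and most points are left uncoloured. The
   encoder looks for a grid point g of the colour of its message in the ball of
   squared radius m P around alpha s, where alpha = P / (P + N), and sends
   g - alpha s; the decoder looks for a coloured grid point in the ball of squared
   radius m D around alpha y, with D slightly above P N / (P + N). By
   Chernoff's bound the sent point lies in the decoding ball. Covering and packing
   only involve the ratio of the numbers of grid points in the two balls, which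
   is about (P / D)^(m/2) for any centers by rescaling the grid, so no volume is
   computed. *)
Require Import Defs.
From mathcomp Require Import all_boot all_order all_algebra.
From mathcomp Require Import all_classical all_reals all_analysis.
From mathcomp Require Import perm measurable_realfun ring lra zify.

Set Implicit Arguments.
Unset Strict Implicit.
Unset Printing Implicit Defensive.

Import Order.TTheory GRing.Theory Num.Theory.
Import numFieldNormedType.Exports.

Local Open Scope classical_set_scope.
Local Open Scope ring_scope.

(** * Integration against probability laws and the Gaussian density *)

Section bounds.
Local Open Scope ereal_scope.

Lemma integral_prob_le d (T : measurableType d) (R : realType)
    (P : probability T R) (f : T -> \bar R) (e : \bar R) :
  measurable_fun [set: T] f -> (forall x, 0 <= f x) -> (forall x, f x <= e) ->
  \int[P]_x f x <= e.
Proof.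
move=> mf f0 fe.
have -> : e = \int[P]_x (cst e x) :> \bar R.
  by rewrite integral_cst//= [P _]probability_setT mule1.
apply: ge0_le_integral => //=.
Qed.

Lemma measurable_section d1 d2 (T1 : measurableType d1) (T2 : measurableType d2)
    (A : set (T1 * T2)) (x : T1) : measurable A -> measurable [set y | A (x, y)].
Proof.
move=> mA; have := measurable_xsection x mA; congr measurable.
by apply/seteqP; split => y /=; rewrite /xsection/= inE.
Qed.

Lemma product_le d1 d2 (T1 : measurableType d1) (T2 : measurableType d2)
    (R : realType) (P1 : probability T1 R) (P2 : probability T2 R)
    (A : set (T1 * T2)) (e : \bar R) :
  measurable A -> (forall x, P2 [set y | A (x, y)] <= e) -> (P1 \x P2) A <= e.
Proof.
move=> mA h; rewrite /product_measure1; apply: integral_prob_le => //=.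
  exact: measurable_fun_xsection.
move=> x; rewrite (_ : xsection A x = [set y | A (x, y)])//.
by apply/seteqP; split => y /=; rewrite /xsection/= inE.
Qed.

(** The density [normal_pdf] and the Radon-Nikodym derivative of [normal_prob] have the same
    integral over every measurable set, so they agree almost everywhere and may be exchanged under
    the integral. *)
Lemma normal_integral (R : realType) (m s : R) (f : measurableTypeR R -> \bar R) :
  measurable_fun [set: measurableTypeR R] f -> (forall x, 0 <= f x) ->
  \int[normal_prob m s]_x f x =
  \int[lebesgue_measure]_x (f x * (normal_pdf m s x)%:E).
Proof.
move=> mf f0.
rewrite -(Radon_Nikodym_SigmaFinite.change_of_variables (normal_prob_dominates m s))//.
apply: ae_eq_integral => //.
- apply: emeasurable_funM => //; apply: (measurable_int lebesgue_measure).
  apply: Radon_Nikodym_SigmaFinite.f_integrable; exact: normal_prob_dominates.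
- apply: emeasurable_funM => //=; apply/measurableT_comp => //=.
  exact: measurable_normal_pdf.
- apply: ae_eqe_mul2l => /=.
  apply: integral_ae_eq => //=.
  + apply: Radon_Nikodym_SigmaFinite.f_integrable; exact: normal_prob_dominates.
  + by apply/measurableT_comp => //; exact: measurable_normal_pdf.
  + move=> E _ mE; rewrite -Radon_Nikodym_SigmaFinite.f_integral//.
    exact: normal_prob_dominates.
Qed.

Lemma gaussian_integral (R : realType) (v : R) (f : R -> \bar R) :
  measurable_fun [set: R] f -> (forall x, 0 <= f x) ->
  \int[gaussian v]_x f x =
  \int[lebesgue_measure]_x (f x * (normal_pdf 0 (Num.sqrt v) x)%:E).
Proof.
move=> mf f0; rewrite -normal_integral//.
(* The identity transports the law from [measurableTypeR R] to [R], which has the same measurable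
   sets under another display. *)
pose h : measurableTypeR R -> R := id.
have mh : measurable_fun [set: measurableTypeR R] h by move=> ? ? ?; rewrite setTI.
transitivity (\int[pushforward (normal_prob 0 (Num.sqrt v)) h]_x f x).
  by apply: eq_measure_integral => A mA _ /=.
by rewrite ge0_integral_pushforward.
Qed.

End bounds.

(** * Chernoff's bound for sums of squares of shifted Gaussians *)

Lemma measurable_fun_gt_cst d (T : measurableType d) (R : realType) (f : T -> R)
    (c : R) :
  measurable_fun [set: T] f -> measurable [set x | c < f x].
Proof.
move=> mf; rewrite -[X in measurable X]setTI.
rewrite (_ : [set x | c < f x] = f @^-1` `]c, +oo[%classic); first exact: mf.
by apply/seteqP; split => x /=; rewrite in_itv/= andbT.
Qed.

(** Completing the square turns the integrand times the density of variance [v] into a multiple of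
    the normal density of mean [m] and variance [s2 = v / (1 - u)]. The ratio [C] of the two peaks
    satisfies [C ^+ 2 = 1 + u / (1 - u)], at most [expR (u / (1 - u))]; hence the half in the
    exponent. *)
Lemma gaussian_exp_sqr (R : realType) (v lam beta p u : R) :
  0 < v -> 0 < lam -> u = 2 * lam * beta ^+ 2 * v -> u < 1 ->
  (\int[gaussian v]_z (expR (lam * (p - beta * z) ^+ 2))%:E <=
   (expR (u / (1 - u) / 2 + lam / (1 - u) * p ^+ 2))%:E)%E.
Proof.
move=> v0 l0 uE u1.
have u'0 : 0 < 1 - u by rewrite subr_gt0.
have u0 : 0 <= u.
  by rewrite uE (mulr_ge0 _ (ltW v0))// (mulr_ge0 _ (sqr_ge0 _))// mulr_ge0// ltW.
pose s2 := v / (1 - u).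
have s20 : 0 < s2 by rewrite divr_gt0.
pose m := - (2 * lam * p * beta * s2).
pose C := normal_peak (Num.sqrt v) / normal_peak (Num.sqrt s2).
have mf : measurable_fun [set: R] (fun z => expR (lam * (p - beta * z) ^+ 2)).
  apply: measurableT_comp => //; apply: measurable_funM => //.
  by apply: measurable_funX; apply: measurable_funB => //; exact: measurable_funM.
have pk0 (x : R) : 0 < x -> 0 < normal_peak (Num.sqrt x).
  by move=> x0; rewrite normal_peak_gt0// gt_eqF// sqrtr_gt0.
rewrite gaussian_integral//; last exact/measurable_EFinP.
rewrite (eq_integral (fun z : measurableTypeR R =>
    (C * expR (lam / (1 - u) * p ^+ 2))%:E *
    (normal_pdf m (Num.sqrt s2) z)%:E)%E); last first.
  move=> z _; rewrite -!EFinM; congr EFin.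
  rewrite !normal_pdfE ?gt_eqF ?sqrtr_gt0// /normal_fun subr0.
  rewrite !sqr_sqrtr ?ltW// mulrCA -expRD.
  rewrite /C [RHS]mulrACA divfK ?gt_eqF ?pk0// -expRD.
  congr (_ * expR _); move: u'0; rewrite /m /s2 uE => u'0; field.
  by rewrite !gt_eqF//.
rewrite ge0_integralZl//=; last 3 first.
- apply/measurable_EFinP; exact: measurable_normal_pdf.
- by move=> z _; rewrite lee_fin normal_pdf_ge0.
- by rewrite lee_fin mulr_ge0 ?expR_ge0// divr_ge0// ltW ?pk0.
rewrite integral_normal_pdf mule1 lee_fin expRD ler_wpM2r ?expR_ge0//.
rewrite -(@ler_pXn2r _ 2) ?nnegrE ?expR_ge0//; last by rewrite divr_ge0 ?ltW ?pk0.
have -> : C ^+ 2 = 1 + u / (1 - u).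
  have pkE (x : R) : 0 < x -> normal_peak (Num.sqrt x) ^+ 2 = (x * pi *+ 2)^-1.
    move=> x0; rewrite /normal_peak exprVn !sqr_sqrtr ?ltW//.
    by rewrite mulrn_wgt0// mulr_gt0// pi_gt0.
  rewrite /C expr_div_n !pkE//.
  rewrite /s2; move: (pi : R) (pi_gt0 R) => q q0; field.
  by rewrite !gt_eqF.
rewrite -expRM_natr.
rewrite (_ : _ * 2%:R = u / (1 - u)); last by field; rewrite gt_eqF.
exact: expR_ge1Dx.
Qed.

(** By induction: [iid P n.+1] is the image of a product measure, so Tonelli's theorem separates the
    first factor from the others. *)
Lemma iid_integral_prod_le d (T : measurableType d) (R : realType)
    (P : probability T R) n (h : 'I_n -> T -> R) (c : 'I_n -> R) :
  (forall i, measurable_fun [set: T] (h i)) -> (forall i x, 0 <= h i x) ->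
  (forall i, \int[P]_x (h i x)%:E <= (c i)%:E)%E ->
  (\int[iid P n]_z (\prod_i h i (tnth z i))%:E <= (\prod_i c i)%:E)%E.
Proof.
have mprod k (g : 'I_k -> T -> R) : (forall i, measurable_fun [set: T] (g i)) ->
    measurable_fun [set: k.-tuple T] (fun z => \prod_i g i (tnth z i)).
  move=> mg; apply: measurable_prod => i _.
  apply: measurableT_comp => //; exact: measurable_tnth.
elim: n h c => [|n IH] h c mh h0 hc.
  apply: integral_prob_le => [|x|x].
  - by apply/measurable_EFinP; exact: mprod.
  - by rewrite big_ord0 lee_fin.
  - by rewrite !big_ord0.
have c0 i : 0 <= c i.
  rewrite -lee_fin; apply: le_trans (hc i).
  by apply: integral_ge0 => x _; rewrite lee_fin.
rewrite /= ge0_integral_distribution; last 2 first.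
  - by apply/measurable_EFinP; exact: mprod.
  - by move=> z; rewrite lee_fin prodr_ge0.
pose H := fun z : n.-tuple T => \prod_i h (lift ord0 i) (tnth z i).
rewrite (eq_integral (fun z => (h ord0 z.1 * H z.2)%:E)); last first.
  move=> [x z] _ /=; congr EFin; rewrite big_ord_recl/=; congr (_ * _).
  by apply: eq_bigr => i _; rewrite tnthS.
have mH : measurable_fun [set: n.-tuple T] H.
  exact: (mprod n (fun i => h (lift ord0 i))).
have H0 z : 0 <= H z by rewrite prodr_ge0.
rewrite fubini_tonelli1//=; last 2 first.
- apply/measurable_EFinP; apply: measurable_funM; first exact: measurableT_comp.
  exact: measurableT_comp.
- by move=> z; rewrite lee_fin mulr_ge0.
rewrite /fubini_F/=.
have hH x : (\int[iid P n]_y (h ord0 x * H y)%:E =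
    (h ord0 x)%:E * \int[iid P n]_y (H y)%:E)%E.
  under eq_integral do rewrite EFinM.
  rewrite ge0_integralZl ?lee_fin//; first exact/measurable_EFinP.
  by move=> y _; rewrite lee_fin.
apply: (@le_trans _ _ (\int[P]_x ((h ord0 x)%:E * (\prod_i c (lift ord0 i))%:E))%E).
  under eq_integral do rewrite hH.
  apply: ge0_le_integral => //=.
  - move=> x _; rewrite mule_ge0 ?lee_fin//.
    by apply: integral_ge0 => z _; rewrite lee_fin.
  - by apply: emeasurable_funM => //; exact/measurable_EFinP.
  - by apply: emeasurable_funM => //; exact/measurable_EFinP.
  - move=> x _; apply: lee_wpmul2l; rewrite ?lee_fin//.
    exact: (IH (fun i => h (lift ord0 i))).
rewrite ge0_integralZr//; last by rewrite lee_fin prodr_ge0.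
- by rewrite [X in (_ <= X%:E)%E]big_ord_recl EFinM lee_wpmul2r// lee_fin prodr_ge0.
- exact/measurable_EFinP.
- by move=> x _; rewrite lee_fin.
Qed.

(** Markov's inequality for the exponential of [lam] times the sum. This exponential is a product
    over the coordinates, and [gaussian_exp_sqr] bounds each factor. *)
Lemma chernoff_sqr (R : realType) (v lam beta c u : R) n (p : 'I_n -> R) :
  0 < v -> 0 < lam -> u = 2 * lam * beta ^+ 2 * v -> u < 1 ->
  (iid (gaussian v) n [set z | (c < \sum_i (p i - beta * tnth z i) ^+ 2)%R] <=
  (expR (n%:R * (u / (1 - u) / 2) + lam / (1 - u) * (\sum_i p i ^+ 2) - lam * c))%:E)%E.
Proof.
move=> v0 l0 uE u1.
pose S (z : n.-tuple R) := \sum_i (p i - beta * tnth z i) ^+ 2.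
have mS : measurable_fun [set: n.-tuple R] S.
  apply: measurable_sum => i; apply: measurable_funX; apply: measurable_funB => //.
  by apply: measurable_funM => //; exact: measurable_tnth.
have mA : measurable [set z | c < S z].
  exact: measurable_fun_gt_cst.
pose h (i : 'I_n) z := expR (lam * (p i - beta * z) ^+ 2).
have prodE z : \prod_i h i (tnth z i) = expR (lam * S z).
  by rewrite /h -expR_sum mulr_sumr.
rewrite expRD expRN EFinM lee_pdivlMr ?expR_gt0//.
apply: (@le_trans _ _ (\int[iid (gaussian v) n]_z (\prod_i h i (tnth z i))%:E)%E).
  rewrite muleC -integral_cst// integral_mkcond.
  under [leRHS]eq_integral do rewrite prodE.
  apply: ge0_le_integral => //=.
  - by move=> z _; rewrite patchE; case: ifP => //; rewrite lee_fin expR_ge0.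
  - by apply/(measurable_restrictT _ _).1 => //.
  - apply/measurable_EFinP.
    by apply: measurableT_comp => //; exact: measurable_funM.
  - move=> z _; rewrite patchE; case: ifPn => [|_]; last first.
      by rewrite lee_fin expR_ge0.
    by rewrite inE/= => cz; rewrite lee_fin ler_expR ler_pM2l// ltW.
apply: (le_trans (iid_integral_prod_le _ _
  (fun i => gaussian_exp_sqr (p i) v0 l0 uE u1))).
- move=> i; apply: measurableT_comp => //; apply: measurable_funM => //.
  by apply: measurable_funX; apply: measurable_funB => //; exact: measurable_funM.
- by move=> i x; exact: expR_ge0.
- rewrite -expR_sum big_split/= sumr_const card_ord -mulr_sumr.
  by rewrite -[X in X + _]mulr_natl.
Qed.

(** * Counting grid points in balls *)

(** A small weight [t] keeps the coefficient of the main term [x] close to one, at the expense of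
    the error term [y]. *)
Lemma sqrD_le_weighted (R : realFieldType) (t x y : R) :
  0 < t -> (x + y) ^+ 2 <= (1 + t) * x ^+ 2 + (1 + t^-1) * y ^+ 2.
Proof.
move=> t0; rewrite -subr_ge0.
rewrite (_ : _ - _ = t^-1 * (t * x - y) ^+ 2).
  by rewrite mulr_ge0 ?sqr_ge0// invr_ge0 ltW.
by field; rewrite gt_eqF.
Qed.

Definition grid_ball (R : realType) (m K : nat) (delta : R) (c : 'I_m -> R) (r : R) :
    {set {ffun 'I_m -> 'I_K.+1}} :=
  [set g : {ffun 'I_m -> 'I_K.+1} | \sum_i (delta * (g i)%:R - c i) ^+ 2 <= r]%SET.

(* Counts by the injection sending (g, s), with s in [0, a)^m, to the quotient and
   the remainder of a g + s + kappa by b, where kappa matches the two centers. *)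
Lemma grid_ball_ratio (R : realType) (m K a b : nat) (delta t r r' : R)
    (c c' : 'I_m -> R) :
  0 < delta -> (0 < a)%N -> (0 < b)%N -> 0 < t ->
  (1 + t) * (a%:R / b%:R) ^+ 2 * r +
    (1 + t^-1) * (m%:R * (delta * (a + b + 1)%:R / b%:R) ^+ 2) <= r' ->
  (forall i x, (x - c' i) ^+ 2 <= r' -> 0 <= x <= delta * K%:R) ->
  (#|grid_ball K delta c r| * a ^ m <= #|grid_ball K delta c' r'| * b ^ m)%N.
Proof.
case: a => // a; case: b => // b d0 _ _ t0 hr hbox.
set A : R := a.+1%:R; set B : R := b.+1%:R.
have B0 : 0 < B by rewrite ltr0n.
(* In units of [delta / B], the translation from the scaled center [A / B * c i] to [c' i], rounded
   down. *)
pose kappa i : int := Num.floor (B * (c' i - A / B * c i) / delta).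
pose h (p : {ffun 'I_m -> 'I_K.+1} * {ffun 'I_m -> 'I_a.+1}) i : int :=
  (a.+1%:Z * (p.1 i : nat)%:Z + (p.2 i : nat)%:Z + kappa i)%R.
pose phi p : {ffun 'I_m -> 'I_K.+1} * {ffun 'I_m -> 'I_b.+1} :=
  ([ffun i => inord `|(h p i %/ b.+1%:Z)%Z|%N],
   [ffun i => inord `|(h p i %% b.+1%:Z)%Z|%N]).
pose D := finset.setX (grid_ball K delta c r) [set: {ffun 'I_m -> 'I_a.+1}]%SET.
pose E := finset.setX (grid_ball K delta c' r') [set: {ffun 'I_m -> 'I_b.+1}]%SET.
have -> : (#|grid_ball K delta c r| * a.+1 ^ m = #|D|)%N.
  by rewrite cardsX cardsT card_ffun !card_ord.
have -> : (#|grid_ball K delta c' r'| * b.+1 ^ m = #|E|)%N.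
  by rewrite cardsX cardsT card_ffun !card_ord.
have rem p i : exists2 j : nat, (h p i %% b.+1%:Z)%Z = j%:Z & (j < b.+1)%N.
  have := modz_ge0 (h p i) (isT : b.+1%:Z != 0).
  have := ltz_pmod (h p i) (isT : (0 < b.+1%:Z)%R).
  by case: (h p i %% b.+1%:Z)%Z => // j jb _; exists j.
have quo p : p \in D ->
  \sum_i (delta * ((h p i %/ b.+1%:Z)%Z)%:~R - c' i) ^+ 2 <= r'.
  rewrite !inE andbT => pr; apply: le_trans hr.
  apply: (@le_trans _ _ (\sum_i ((1 + t) * (A / B * (delta * (p.1 i)%:R - c i)) ^+ 2 +
      (1 + t^-1) * (delta * (a.+1 + b.+1 + 1)%:R / B) ^+ 2))).
    apply: ler_sum => i _.
    have [j hj jb] := rem p i.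
    have := divz_eq (h p i) b.+1%:Z; rewrite hj.
    set q := (h p i %/ b.+1%:Z)%Z => hE.
    have {}hE : A * (p.1 i)%:R + (p.2 i)%:R + (kappa i)%:~R = q%:~R * B + j%:R :> R.
      have := congr1 (fun z : int => z%:~R : R) hE.
      by rewrite /h !(rmorphD, rmorphM)/= !pmulrn.
    have := floor_itv (B * (c' i - A / B * c i) / delta).
    rewrite -/(kappa i) rmorphD rmorph1/= => /andP[k1 k2].
    set k := (kappa i)%:~R in hE k1 k2.
    (* The rounding error of the map: in units of [delta / B], the added [s], the remainder and the
       floor in [kappa] contribute at most [a.+1], [b.+1] and 1. *)
    pose e := delta * q%:~R - c' i - A / B * (delta * (p.1 i)%:R - c i).
    have eE : e = delta / B *
        ((p.2 i)%:R - j%:R + k - B * (c' i - A / B * c i) / delta).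
      rewrite /e (_ : q%:~R = (A * (p.1 i)%:R + (p.2 i)%:R + k - j%:R) / B).
        by field; rewrite !gt_eqF.
      by rewrite hE; field; rewrite gt_eqF.
    have e2 : e ^+ 2 <= (delta * (a.+1 + b.+1 + 1)%:R / B) ^+ 2.
      rewrite eE (mulrAC delta _ B^-1) [leLHS]exprMn [leRHS]exprMn ler_wpM2l ?sqr_ge0//.
      have p20 : 0 <= (p.2 i)%:R :> R by [].
      have p2a : (p.2 i)%:R <= A :> R by rewrite ler_nat ltnW.
      have j0 : 0 <= j%:R :> R by [].
      have jB : j%:R <= B by rewrite ler_nat ltnW.
      rewrite -[leLHS]real_normK ?num_real// ler_pXn2r ?nnegrE//.
      rewrite !natrD -/A -/B ler_norml.
      move: k1 k2; set x := _ / delta; move: x => x k1 k2.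
      move: (p.2 i)%:R j%:R p20 p2a j0 jB k1 k2 => u w p20 p2a j0 jB k1 k2.
      by apply/andP; split; lra.
    rewrite (_ : delta * q%:~R - c' i =
      A / B * (delta * (p.1 i)%:R - c i) + e); last first.
      by rewrite /e; ring.
    apply: le_trans (sqrD_le_weighted _ _ t0) _.
    by rewrite lerD2l ler_wpM2l// addr_ge0// invr_ge0 ltW.
  rewrite big_split/= sumr_const card_ord -[X in _ + X]mulr_natl mulrCA lerD2r.
  under eq_bigr do rewrite exprMn mulrA.
  rewrite -mulr_sumr ler_wpM2l// mulr_ge0 ?sqr_ge0//.
  by rewrite addr_ge0// ltW.
(* By [hbox] the quotient is a grid coordinate, so that [inord] in [phi] does not truncate it. *)
have quoE p i : p \in D -> exists2 q : nat, (h p i %/ b.+1%:Z)%Z = q%:Z & (q < K.+1)%N.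
  move=> /quo hq.
  have : (delta * ((h p i %/ b.+1%:Z)%Z)%:~R - c' i) ^+ 2 <= r'.
    apply: le_trans hq; rewrite (bigD1 i)//= lerDl.
    by apply: sumr_ge0 => k _; rewrite sqr_ge0.
  move=> /hbox; rewrite pmulr_rge0// ler_pM2l// => /andP[].
  rewrite ler0z; case: (h p i %/ b.+1%:Z)%Z => // q _.
  by rewrite -pmulrn ler_nat => qK; exists q.
have injphi : {in D &, injective phi}.
  move=> p p' pD p'D [] /ffunP e1 /ffunP e2.
  have hh i : h p i = h p' i.
    rewrite (divz_eq (h p i) b.+1%:Z) (divz_eq (h p' i) b.+1%:Z).
    have := e1 i; rewrite !ffunE.
    have [q1 -> q1K] := quoE p i pD; have [q2 -> q2K] := quoE p' i p'D.
    move=> /(congr1 val); rewrite /= !inordK// => ->.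
    have := e2 i; rewrite !ffunE.
    have [j1 -> j1K] := rem p i; have [j2 -> j2K] := rem p' i.
    by move=> /(congr1 val); rewrite /= !inordK// => ->.
  (* Quotient and remainder give back [a.+1 * g + s]; as [s < a.+1], a second Euclidean division
     recovers [g] and [s]. *)
  have nn i : (a.+1 * p.1 i + p.2 i = a.+1 * p'.1 i + p'.2 i)%N.
    have := hh i; rewrite /h => /addIr; rewrite -!PoszM -!PoszD.
    by move=> /(congr1 absz).
  case: p p' nn {pD p'D e1 e2 hh} => [g s] [g' s']/= nn.
  congr (_, _); apply/ffunP => i; apply: val_inj => /=.
    have := congr1 (fun x => x %/ a.+1)%N (nn i).
    by rewrite !(mulnC a.+1) !divnMDl// !divn_small// !addn0.
  have := congr1 (fun x => x %% a.+1)%N (nn i).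
  by rewrite !(mulnC a.+1) !modnMDl !modn_small.
rewrite -(card_in_imset injphi); apply: subset_leq_card.
apply/fintype.subsetP => _ /imsetP[p pD ->]; rewrite !inE andbT/=.
have := quo p pD; congr (_ <= _); apply: eq_bigr => i _.
by rewrite ffunE; have [q -> qK] := quoE p i pD; rewrite inordK.
Qed.

(** * Counting colourings: covering and packing *)

(** Bernoulli's inequality [(1 - 1 / q) ^ k <= q / (q + k)], cleared of denominators. *)
Lemma bernoulli_pred (q k : nat) : (q.-1 ^ k * (q + k) <= q ^ k.+1)%N.
Proof.
elim: k => [|k IH]; first by rewrite expn0 mul1n addn0 expn1.
rewrite expnSr (expnS q k.+1).
apply: leq_trans (leq_mul (leqnn q) IH).
rewrite [leqRHS]mulnCA -mulnA leq_mul2l; apply/orP; right.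
by case: q {IH} => // q; nia.
Qed.

(** Covering: in a uniformly random colouring, [B] misses the colour [c0] with probability
    [(1 - 1 / #|C|) ^ #|B|], which Bernoulli's inequality bounds by [#|C| / (#|C| + #|B|)]. *)
Lemma card_avoiding (G C : finType) (c0 : C) (B : {set G}) :
  (#|[set f : {ffun G -> C} | [forall g in B, f g != c0]]%SET| * (#|C| + #|B|) <=
   #|C| * #|{: {ffun G -> C}}|)%N.
Proof.
pose F g : pred C := if g \in B then predC1 c0 else predT.
rewrite (_ : #|[set f : {ffun G -> C} | [forall g in B, f g != c0]]%SET| =
  #|family F|); last first.
  apply: eq_card => f; rewrite inE; apply/forall_inP/familyP => H g.
    by rewrite /F; case: ifP => // gB; rewrite inE; exact: H.
  by move=> gB; have := H g; rewrite /F gB inE.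
have -> : #|family F| = (#|C|.-1 ^ #|B| * #|C| ^ (#|G| - #|B|))%N.
  rewrite card_family foldrE big_image/=.
  rewrite (bigID (mem B))/=.
  rewrite (eq_bigr (fun => #|C|.-1)); last by move=> g gB; rewrite /F gB cardC1.
  rewrite [X in (_ * X)%N](eq_bigr (fun => #|C|)); last first.
    by move=> g /negbTE gB; rewrite /F gB; exact: eq_card.
  rewrite !big_const !iter_muln_1; congr (_ * _ ^ _)%N.
  by rewrite -(cardC (mem B)) addKn; apply: eq_card.
rewrite card_ffun mulnAC -{2}(subnKC (max_card (mem B))) expnD mulnA -expnS.
by rewrite leq_mul2r bernoulli_pred orbT.
Qed.

(* Renaming the colours by a transposition fixing [c] does not change [f^-1(c)],
   so that all colours other than [c] are equally frequent in [B (f^-1(c))]. *)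
Lemma card_collision (G C : finType) (c : C) (V : {set C})
    (B : {set G} -> {set G}) (n : nat) :
  (forall A, #|B A| <= n)%N -> c \notin V ->
  (#|[set f : {ffun G -> C} | [exists g in B [set g | f g == c]%SET, f g \in V]]%SET| *
     #|C|.-1 <= #|V| * (n * #|{: {ffun G -> C}}|))%N.
Proof.
move=> Bn cV.
pose b (f : {ffun G -> C}) := B [set g | f g == c]%SET.
pose T v := (\sum_(f : {ffun G -> C}) #|[set g in b f | f g == v]%SET|)%N.
have Teq v v' : v != c -> v' != c -> (T v <= T v')%N.
  move=> vc v'c.
  pose s (f : {ffun G -> C}) : {ffun G -> C} := [ffun g => tperm v v' (f g)].
  have sK : cancel s s by move=> f; apply/ffunP => g; rewrite !ffunE tpermK.
  rewrite /T (reindex_inj (can_inj sK))/=; apply: leq_sum => f _.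
  apply: subset_leq_card; apply/fintype.subsetP => g; rewrite !inE.
  have -> : b (s f) = b f.
    rewrite /b; congr (B _); apply/setP => x; rewrite !inE ffunE.
    by rewrite -{1}(tpermD vc v'c) (inj_eq perm_inj).
  by rewrite ffunE -{2}(tpermR v v') (inj_eq perm_inj).
(* The numbers [T v'] with [v' != c] are all equal, and together they count at most [n] points per
   colouring. *)
have TS v : v != c -> (T v * #|C|.-1 <= n * #|{: {ffun G -> C}}|)%N.
  move=> vc; apply: (@leq_trans (\sum_(v' | v' != c) T v')%N).
    rewrite -(cardC1 c) mulnC -sum_nat_const; apply: leq_sum => v' v'c.
    exact: Teq.
  rewrite exchange_big/= mulnC -sum_nat_const; apply: leq_sum => f _.
  apply: leq_trans (Bn [set g | f g == c]%SET); rewrite -/(b f).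
  rewrite -sum1_card (partition_big f predT)//= [leqRHS](bigD1 c)//=.
  apply: leq_trans (leq_addl _ _); apply: leq_sum => v' _.
  by rewrite -sum1_card; apply/eq_leq/eq_bigl => g; rewrite !inE.
apply: (@leq_trans ((\sum_(v in V) T v) * #|C|.-1)%N).
  rewrite leq_mul2r; apply/orP; right.
  rewrite exchange_big/= -sum1_card big_mkcond/=; apply: leq_sum => f _.
  case: ifP => //; rewrite inE => /exists_inP[g gB fgV].
  rewrite (bigD1 (f g))//= -[X in (X < _)%N]/0%N.
  apply: leq_trans (leq_addr _ _); apply/card_gt0P; exists g.
  by rewrite inE gB/=.
rewrite big_distrl/= -sum_nat_const; apply: leq_sum => v vV; apply: TS.
by apply: contraNneq cV => <-.
Qed.

(** * Measurability of maps into countable types *)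

Section discrete.
Context d (T : measurableType d).

(* Measurability of a map into a countable type, which then needs no
   measurable structure. *)
Definition discrete_measurable (C : Type) (phi : T -> C) :=
  forall c, measurable [set x | phi x = c].

Lemma measurable_preimage_countable (C : countType) (phi : T -> C) (F : C -> set T) :
  discrete_measurable phi -> (forall c, measurable (F c)) ->
  measurable [set x | F (phi x) x].
Proof.
move=> mphi mF.
rewrite (_ : [set x | _] = \bigcup_c ([set x | phi x = c] `&` F c)).
  apply: countable_bigcupT_measurable => [|c]; first exact: countableP.
  exact: measurableI.
by apply/seteqP; split => x /= => [Fx|[c _ [<-]]//]; exists (phi x).
Qed.

Lemma discrete_measurable_comp (C : countType) (C' : Type) (phi : T -> C)
    (h : C -> C') :
  discrete_measurable phi -> discrete_measurable (fun x => h (phi x)).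
Proof.
move=> mphi c'.
apply: (@measurable_preimage_countable _ phi (fun c => [set _ | h c = c'])) => // c.
have [h'|h'] := pselect (h c = c').
  by rewrite (_ : [set _ | _] = setT)//; apply/seteqP; split.
by rewrite (_ : [set _ | _] = set0)//; apply/seteqP; split.
Qed.

Lemma measurable_fun_discrete d' (U : measurableType d') (C : countType) (phi : T -> C)
    (h : C -> T -> U) :
  discrete_measurable phi -> (forall c, measurable_fun [set: T] (h c)) ->
  measurable_fun [set: T] (fun x => h (phi x) x).
Proof.
move=> mphi mh _ Y mY; rewrite setTI.
apply: (@measurable_preimage_countable _ phi (fun c => h c @^-1` Y)) => // c.
by rewrite -[X in measurable X]setTI; exact: mh.
Qed.

Lemma discrete_measurable_pair (C C' : Type) (phi : T -> C) (psi : T -> C') :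
  discrete_measurable phi -> discrete_measurable psi ->
  discrete_measurable (fun x => (phi x, psi x)).
Proof.
move=> mphi mpsi [c c'].
rewrite (_ : [set x | _] = [set x | phi x = c] `&` [set x | psi x = c']).
  exact: measurableI.
by apply/seteqP; split => x /= [-> ->].
Qed.

Lemma discrete_measurable_ffun (I : finType) (C : Type) (phi : I -> T -> C) :
  (forall i, discrete_measurable (phi i)) ->
  discrete_measurable (fun x => [ffun i => phi i x]).
Proof.
move=> mphi c.
rewrite (_ : [set x | _] = \bigcap_(i in [set: I]) [set x | phi i x = c i]).
  apply: fin_bigcap_measurable => [|i _]; first exact: finite_finset.
  exact: mphi.
apply/seteqP; split => x /=; first by move=> <- i _; rewrite ffunE.
by move=> h; apply/ffunP => i; rewrite ffunE; exact: h.
Qed.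

Lemma discrete_measurable_bool (b : T -> bool) :
  measurable [set x | b x] -> discrete_measurable b.
Proof.
move=> mb [|]; first exact: mb.
rewrite (_ : [set x | b x = false] = ~` [set x | b x]); first exact: measurableC.
by apply/seteqP; split => x /=; case: (b x).
Qed.

Lemma discrete_measurable_floor (R : realType) (f : T -> R) :
  measurable_fun [set: T] f -> discrete_measurable (fun x => Num.floor (f x)).
Proof.
move=> mf z.
rewrite (_ : [set x | _] = f @^-1` `[z%:~R, (z + 1)%:~R[%classic).
  by rewrite -[X in measurable X]setTI; exact: mf.
apply/seteqP; split => x /=; rewrite in_itv/=.
  by move=> <-; exact: floor_itv.
by move=> h; exact: floor_def.
Qed.

Lemma discrete_measurable_ord n (f : T -> 'I_n.+1) :
  measurable_fun [set: T] f -> discrete_measurable f.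
Proof. by move=> mf c; have := mf measurableT [set c]; rewrite setTI; exact. Qed.

Lemma discrete_measurable_set (I : finType) (b : I -> T -> bool) :
  (forall i, measurable [set x | b i x]) ->
  discrete_measurable (fun x => [set i | b i x]%SET).
Proof.
move=> mb.
rewrite (_ : (fun _ => _) = fun x => [set i | [ffun i => b i x] i]%SET); last first.
  by apply/funext => x; apply/setP => i; rewrite !inE ffunE.
apply: (@discrete_measurable_comp _ _ _
  (fun c : {ffun I -> bool} => [set i | c i]%SET)).
by apply: discrete_measurable_ffun => i; exact: discrete_measurable_bool.
Qed.

Lemma discrete_measurable_grid_ball (R : realType) m K (delta r : R)
    (c : T -> 'I_m -> R) :
  (forall i, measurable_fun [set: T] (fun x => c x i)) ->
  discrete_measurable (fun x => grid_ball K delta (c x) r).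
Proof.
move=> mc; apply: discrete_measurable_set => g.
pose S x := \sum_i (delta * (g i)%:R - c x i) ^+ 2.
have mS : measurable_fun [set: T] S.
  by apply: measurable_sum => i; apply: measurable_funX; exact: measurable_funB.
rewrite (_ : [set x | _] = ~` [set x | r < S x]).
  by apply: measurableC; exact: measurable_fun_gt_cst.
by apply/seteqP; split => x /=; rewrite leNgt => /negP.
Qed.

End discrete.

Lemma discrete_measurable_precomp d (T : measurableType d) d' (T' : measurableType d')
    (C : Type) (phi : T' -> C) (h : T -> T') :
  measurable_fun [set: T] h -> discrete_measurable phi ->
  discrete_measurable (fun x => phi (h x)).
Proof. by move=> mh mphi c; have := mh measurableT _ (mphi c); rewrite setTI. Qed.

(** * Announcing a label from a countable set in one real symbol *)

Section cooperation.
Context {R : realType}.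
Variables (L : countType) (tau : R).
Hypothesis tau0 : 0 < tau.

(** However many labels there are, they get distinct reals between 0 and [tau]: one symbol of small
    amplitude, observed exactly, reveals the label. *)
Definition announce (l : L) : R := tau / (pickle l).+1%:R.

Definition read (l0 : L) (x : R) : L := xget l0 [set l | announce l = x].

Lemma announce_bound l : 0 < announce l <= tau.
Proof.
rewrite /announce divr_gt0//= ler_pdivrMr//.
by rewrite ler_peMr ?ler1n// ltW.
Qed.

Lemma announce_inj : injective announce.
Proof.
move=> l l' /(mulfI (lt0r_neq0 tau0)) /invr_inj/eqP.
by rewrite eqr_nat eqSS => /eqP; exact: (pcan_inj pickleK).
Qed.

Lemma announceK l0 : cancel announce (read l0).
Proof. by move=> l; apply: xget_unique => // l' /announce_inj. Qed.

Lemma discrete_measurable_read l0 : discrete_measurable (read l0).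
Proof.
move=> l; have [->{l}|ll0] := eqVneq l l0; last first.
  rewrite (_ : [set x | _] = [set announce l])//.
  apply/seteqP; split => x /=; last by move=> ->; exact: announceK.
  by rewrite /read; case: xgetP => [l' _ /= <- ->//|_ e]; rewrite e eqxx in ll0.
(* The fibre of the default [l0] also contains every real that announces nothing; its complement is
   countable. *)
rewrite (_ : [set x | _] = ~` \bigcup_(l in [set l | l <> l0]) [set announce l]).
  apply: measurableC; rewrite bigcup_mkcond.
  apply: countable_bigcupT_measurable => [|l]; first exact: countableP.
  by case: ifP.
apply/seteqP; split => x /=.
  by move=> h [l /= ll0 xl]; apply: ll0; rewrite -h xl announceK.
move=> h; rewrite /read; case: xgetP => // l _ /= lx.
by apply: contrapT => ll0; apply: h; exists l.
Qed.

End cooperation.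

(** * The encoding functions *)

Section encoder.
Context {R : realType} (m : nat) (tau : R).
Hypothesis tau0 : 0 < tau.
Local Notation state := (m.+1.-tuple R).
Local Notation quantized := {ffun 'I_m -> int}.

(** Time 0 is spent on the announcements; the [m] later times carry the dirty-paper code. *)
Definition late (s : state) (i : 'I_m) : R := tnth s (lift ord0 i).

Definition quantize (s : state) : quantized := [ffun i => Num.floor (late s i / tau)].

(** The part of its own state that an encoder does not announce; cancelling it costs at most
    [tau ^+ 2] per symbol. *)
Definition residue (s : state) (i : 'I_m) : R := late s i - tau * (quantize s i)%:~R.

Lemma residue_bound s i : 0 <= residue s i <= tau.
Proof.
rewrite /residue ffunE.
have := floor_itv (late s i / tau); rewrite rmorphD rmorph1/= => /andP[h1 h2].
rewrite -[X in X - _](divfK (lt0r_neq0 tau0)) mulrC -mulrBr.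
rewrite pmulr_rge0// subr_ge0 h1/= -[leRHS]mulr1 ler_pM2l//.
by rewrite lerBlDl ltW.
Qed.

Lemma measurable_late i : measurable_fun [set: state] (late ^~ i).
Proof. exact: measurable_tnth. Qed.

Lemma discrete_measurable_quantize : discrete_measurable quantize.
Proof.
apply: discrete_measurable_ffun => i; apply: discrete_measurable_floor.
by apply: measurable_funM => //; exact: measurable_late.
Qed.

Lemma measurable_residue i : measurable_fun [set: state] (residue ^~ i).
Proof.
apply: measurable_funB; first exact: measurable_late.
apply: measurable_funM => //.
apply: (@measurable_fun_discrete _ _ _ _ _ quantize (fun q _ => (q i)%:~R : R)) => //.
exact: discrete_measurable_quantize.
Qed.

(* At time 0 the encoder announces its message and its quantized state; from
   then on it sends the fraction [c] of the common input [X], which depends on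
   both announcements, and cancels the residue of its own state. *)
Definition encoder (M M' : nat) (c : R)
    (X : 'I_M.+1 * quantized -> 'I_M'.+1 * quantized -> state -> 'I_m -> R) (j : nat) :
    'I_M.+1 * state * state * j.-tuple R -> R :=
  match j with
  | 0 => fun p => announce tau (p.1.1.1, quantize p.1.2)
  | t.+1 => fun p =>
      if insub t is Some i then
        c * X (p.1.1.1, quantize p.1.2)
              (read tau (ord0, [ffun=> 0]) (thead p.2)) p.1.1.2 i
        - residue p.1.2 i
      else 0
  end.

Lemma measurable_encoder M M' c X j :
  (forall l l' i, measurable_fun [set: state] (fun s => X l l' s i)) ->
  measurable_fun [set: 'I_M.+1 * state * state * j.-tuple R] (@encoder M M' c X j).
Proof.
move=> mX.
have mlabel j' : discrete_measurable
    (fun p : 'I_M.+1 * state * state * j'.-tuple R => (p.1.1.1, quantize p.1.2)).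
  apply: discrete_measurable_pair.
    by apply: discrete_measurable_ord; do 2 apply: measurableT_comp => //.
  apply: (@discrete_measurable_precomp _ _ _ _ _ quantize (fun p => p.1.2)).
    exact: measurableT_comp.
  exact: discrete_measurable_quantize.
case: j => [|t] /=.
  by apply: (measurable_fun_discrete (h := fun l _ => announce tau l) (mlabel 0%N)).
case: insub => [i|//].
apply: measurable_funB; last first.
  by apply: (measurableT_comp (measurable_residue i)); exact: measurableT_comp.
apply: measurable_funM => //.
have mread : discrete_measurable (fun p : 'I_M.+1 * state * state * t.+1.-tuple R =>
    read tau (ord0 : 'I_M'.+1, [ffun=> 0] : quantized) (thead p.2)).
  apply: (discrete_measurable_precomp (h := fun p => thead p.2)).
    by apply: (measurableT_comp (measurable_tnth ord0)).
  exact: discrete_measurable_read.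
apply: (measurable_fun_discrete (h := fun ll p => X ll.1 ll.2 p.1.1.2 i)
  (discrete_measurable_pair (mlabel _) mread)) => ll.
by apply: (measurableT_comp (mX _ _ _)); do 2 apply: measurableT_comp => //.
Qed.

End encoder.

(** * Unfolding the recursion between the symbols of the two encoders *)

Section inputs.
Context {R : realType} (n m1 m2 : nat) (c : @Defs.code R n m1 m2).
Local Notation sample := (('I_m1.+1 * 'I_m2.+1) *
  (n.-tuple R * n.-tuple R * n.-tuple R * n.-tuple R))%type.
Implicit Type w : sample.

Lemma tnth_inputs1 w k (j : 'I_k) :
  tnth (inputs c w k).1 j = enc1 c j (W1 w, S0 w, S1 w, (inputs c w j).2).
Proof.
elim: k j => [[]//|k IH] j.
rewrite (tnth_nth 0) /= nth_rcons size_tuple.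
case: (ltngtP j k) => [jk|jk|-> //]; last by move: (ltn_ord j); rewrite ltnNge jk.
by rewrite -(IH (Ordinal jk)) (tnth_nth 0).
Qed.

Lemma tnth_inputs2 w k (j : 'I_k) :
  tnth (inputs c w k).2 j = enc2 c j (W2 w, S0 w, S2 w, (inputs c w j).1).
Proof.
elim: k j => [[]//|k IH] j.
rewrite (tnth_nth 0) /= nth_rcons size_tuple.
case: (ltngtP j k) => [jk|jk|-> //]; last by move: (ltn_ord j); rewrite ltnNge jk.
by rewrite -(IH (Ordinal jk)) (tnth_nth 0).
Qed.

End inputs.

Lemma discrete_measurable_fun d d' (T : measurableType d) (U : measurableType d')
    (C : countType) (phi : T -> C) (h : C -> U) :
  discrete_measurable phi -> measurable_fun [set: T] (fun x => h (phi x)).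
Proof. by move=> mphi; apply: (measurable_fun_discrete (h := fun c _ => h c) mphi). Qed.

(** * The dirty-paper code and the channel it sees *)

Section dirty_paper.
Context {R : realType}.
Variables (m M1 M2 K k : nat) (delta r1 r2 al off tau c1 c2 : R).
Local Notation state := (m.+1.-tuple R).
Local Notation quantized := {ffun 'I_m -> int}.
Local Notation message := ('I_M1.+1 * 'I_M2.+1)%type.
Local Notation grid := {ffun 'I_m -> 'I_K.+1}.
Local Notation ball := (grid_ball K delta).
Variable f : {ffun grid -> message * 'I_k.+1}.

(** Grid coordinates are nonnegative; the translation [off], later half the side of the grid, brings
    the scaled state to its middle. *)
Definition center (s : 'I_m -> R) (i : 'I_m) : R := al * s i + off.

(* Grid points of colour [(w, 0)] are the codewords of [w]; points of colour
   [(w, j)] with [j != 0] are unused. *)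
Definition codeword (w : message) (s : 'I_m -> R) : option grid :=
  [pick g in ball (center s) r1 | f g == (w, ord0)].

(** The default 0, taken when no codeword lies in the ball, makes the power bound hold for every
    state. *)
Definition dpc_input (w : message) (s : 'I_m -> R) (i : 'I_m) : R :=
  if codeword w s is Some g then delta * (g i)%:R - center s i else 0.

Definition dpc_decoder (y : 'I_m -> R) : message :=
  if [pick g in ball (center y) r2 | (f g).2 == ord0] is Some g then (f g).1
  else (ord0, ord0).

(** The state as both encoders know it after the announcements: [s0] exactly, the two private states
    up to their residues. *)
Definition known_state (s0 : state) (q1 q2 : quantized) (i : 'I_m) : R :=
  late s0 i + tau * (q1 i)%:~R + tau * (q2 i)%:~R.

Lemma sum_dpc_input_le w s : 0 <= r1 -> \sum_i dpc_input w s i ^+ 2 <= r1.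
Proof.
rewrite /dpc_input /codeword; case: pickP => [g /andP[+ _] _|_ r10].
  by rewrite inE.
by rewrite big1// => i _; rewrite expr0n.
Qed.

Lemma measurable_dpc_input d (T : measurableType d) w (s : T -> 'I_m -> R) i :
  (forall i, measurable_fun [set: T] (fun x => s x i)) ->
  measurable_fun [set: T] (fun x => dpc_input w (s x) i).
Proof.
move=> ms.
have mc j : measurable_fun [set: T] (fun x => center (s x) j).
  by apply: measurable_funD => //; exact: measurable_funM.
have mB := @discrete_measurable_grid_ball _ _ _ _ K delta r1 _ mc.
pose h (B : {set grid}) (x : T) := if [pick g in B | f g == (w, ord0)] is Some g
              then delta * (g i)%:R - center (s x) i else 0.
apply: (measurable_fun_discrete (h := h) mB) => B.
by rewrite /h; case: pickP => // g _; exact: measurable_funB.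
Qed.

Lemma measurable_dpc_decoder d (T : measurableType d) (y : T -> 'I_m -> R) :
  (forall i, measurable_fun [set: T] (fun x => y x i)) ->
  measurable_fun [set: T] (fun x => dpc_decoder (y x)).
Proof.
move=> my.
have mc j : measurable_fun [set: T] (fun x => center (y x) j).
  by apply: measurable_funD => //; exact: measurable_funM.
pose h (B : {set grid}) :=
  if [pick g in B | (f g).2 == ord0] is Some g then (f g).1 else (ord0, ord0).
have mB := @discrete_measurable_grid_ball _ _ _ _ K delta r2 _ mc.
exact: (@discrete_measurable_fun _ _ _ _ {set grid} _ h mB).
Qed.

Lemma measurable_known_state q1 q2 i :
  measurable_fun [set: state] (fun s => known_state s q1 q2 i).
Proof.
apply: measurable_funD => //; apply: measurable_funD => //.
exact: measurable_late.
Qed.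

Hypothesis tau0 : 0 < tau.

Let common1 (l : 'I_M1.+1 * quantized) (l' : 'I_M2.+1 * quantized) s :=
  dpc_input (l.1, l'.1) (known_state s l.2 l'.2).
Let common2 (l : 'I_M2.+1 * quantized) (l' : 'I_M1.+1 * quantized) s :=
  dpc_input (l'.1, l.1) (known_state s l'.2 l.2).

Let measurable_enc1 j : measurable_fun setT (encoder tau c1 common1 (j := j)).
Proof.
apply: measurable_encoder => // l l' i.
by apply: measurable_dpc_input => i'; exact: measurable_known_state.
Qed.

Let measurable_enc2 j : measurable_fun setT (encoder tau c2 common2 (j := j)).
Proof.
apply: measurable_encoder => // l l' i.
by apply: measurable_dpc_input => i'; exact: measurable_known_state.
Qed.

Let measurable_dec : measurable_fun [set: state] (fun y => dpc_decoder (late y)).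
Proof. by apply: measurable_dpc_decoder => i; exact: measurable_late. Qed.

Definition dpc_code : @Defs.code R m.+1 M1 M2 :=
  Code (fun j => mfun_Sub (mem_set (@measurable_enc1 j)))
       (fun j => mfun_Sub (mem_set (@measurable_enc2 j)))
       (mfun_Sub (mem_set measurable_dec)).

Local Notation sample := (message * (state * state * state * state))%type.
Implicit Type w : sample.

Definition common_state w : 'I_m -> R :=
  known_state (S0 w) (quantize tau (S1 w)) (quantize tau (S2 w)).

Lemma X1_first w : tnth (X1 dpc_code w) ord0 = announce tau (W1 w, quantize tau (S1 w)).
Proof. by rewrite /X1 tnth_inputs1. Qed.

Lemma X2_first w : tnth (X2 dpc_code w) ord0 = announce tau (W2 w, quantize tau (S2 w)).
Proof. by rewrite /X2 tnth_inputs2. Qed.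

Lemma X1_late w i : tnth (X1 dpc_code w) (lift ord0 i) =
  c1 * dpc_input w.1 (common_state w) i - residue tau (S1 w) i.
Proof.
rewrite /X1 tnth_inputs1 lift0 /=.
have -> : insub (i : nat) = Some i :> option 'I_m by exact: valK.
by rewrite [thead _]tnth_inputs2 /= announceK.
Qed.

Lemma X2_late w i : tnth (X2 dpc_code w) (lift ord0 i) =
  c2 * dpc_input w.1 (common_state w) i - residue tau (S2 w) i.
Proof.
rewrite /X2 tnth_inputs2 lift0 /=.
have -> : insub (i : nat) = Some i :> option 'I_m by exact: valK.
by rewrite [thead _]tnth_inputs1 /= announceK.
Qed.

(** The two fractions of the common input add up to one and each residue is cancelled by its owner.
    What remains is a channel with one transmitter that knows the state. *)
Lemma late_Y w i : c1 + c2 = 1 ->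
  late (Y dpc_code w) i =
  dpc_input w.1 (common_state w) i + common_state w i + late (Z w) i.
Proof.
move=> c12; rewrite /late tnth_mktuple X1_late X2_late.
set x := dpc_input _ _ _.
rewrite /common_state /known_state /residue /late.
rewrite -[x in RHS]mul1r -c12; ring.
Qed.

Lemma dec_dpc_code w : dec dpc_code (Y dpc_code w) = dpc_decoder (late (Y dpc_code w)).
Proof. by []. Qed.

End dirty_paper.

(** * The random coding bound *)

(** Exchanging sum and integral, the average of [P (A f)] over [f] is at most [q], and some [f] does
    no worse than the average. *)
Lemma exists_low_probability d (T : measurableType d) (R : realType)
    (P : probability T R) (F : finType) (f0 : F) (A : F -> set T) (q : R) :
  (forall f, measurable (A f)) ->
  (forall x, \sum_f (\1_(A f) x : R) <= q * #|F|%:R) ->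
  exists f, (P (A f) <= q%:E)%E.
Proof.
move=> mA hq; apply: contrapT => /forallNP hP.
have Pfin f : P (A f) \is a fin_num by rewrite fin_num_measure.
have : \sum_f fine (P (A f)) <= q * #|F|%:R.
  rewrite -lee_fin -sumEFin.
  have PE f : P (A f) = (\int[P]_x (\1_(A f) x)%:E)%E.
    by rewrite integral_indic// setIT.
  under eq_bigr => f _ do rewrite fineK// PE.
  rewrite -ge0_integral_sum//.
  apply: integral_prob_le => [|x|x].
  - by apply: emeasurable_sum => f; apply/measurable_EFinP.
  - by apply: sume_ge0 => f _; rewrite lee_fin.
  - by rewrite sumEFin lee_fin.
- by move=> f; apply/measurable_EFinP.
rewrite leNgt => /negP; apply; rewrite mulr_natr -sumr_const.
apply: ltr_sum; first by apply/hasP; exists f0.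
move=> f _; rewrite -lte_fin fineK// ltNge; apply/negP; exact: hP.
Qed.

Lemma average_power_le d (T : measurableType d) (R : realType) (P : probability T R)
    n (X : T -> n.-tuple R) (p : R) :
  (0 < n)%N -> (forall j, measurable_fun [set: T] (fun w => tnth (X w) j)) ->
  (forall w, \sum_j tnth (X w) j ^+ 2 <= n%:R * p) ->
  ((n%:R^-1)%:E * \sum_(j < n) 'E_P[fun w => (tnth (X w) j ^+ 2)%R] <= p%:E)%E.
Proof.
move=> n0 mX hX.
under eq_bigr do rewrite unlock.
rewrite -ge0_integral_sum//; last 2 first.
- by move=> j; apply/measurable_EFinP; apply: measurable_funX.
- by move=> j w _; rewrite lee_fin sqr_ge0.
have -> : p%:E = ((n%:R^-1)%:E * (n%:R * p)%:E)%E.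
  by rewrite -EFinM mulKf// pnatr_eq0 -lt0n.
rewrite lee_wpmul2l ?lee_fin ?invr_ge0//.
apply: integral_prob_le => [|w|w].
- by apply: emeasurable_sum => j; apply/measurable_EFinP; apply: measurable_funX.
- by apply: sume_ge0 => j _; rewrite lee_fin sqr_ge0.
- by rewrite sumEFin lee_fin.
Qed.

Section random_coding.
Context {R : realType}.
Variables (m M1 M2 K k : nat) (delta r1 r2 al off tau c1 c2 : R).
Local Notation state := (m.+1.-tuple R).
Local Notation message := ('I_M1.+1 * 'I_M2.+1)%type.
Local Notation grid := {ffun 'I_m -> 'I_K.+1}.
Local Notation colour := (message * 'I_k.+1)%type.
Local Notation ball := (grid_ball K delta).
Local Notation sample := (message * (state * state * state * state))%type.
Implicit Types (f : {ffun grid -> colour}) (w : sample).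
Hypothesis tau0 : 0 < tau.
Hypothesis c12 : c1 + c2 = 1.
Hypothesis r10 : 0 <= r1.

Local Notation scheme F :=
  (@dpc_code R m M1 M2 K k delta r1 r2 al off tau c1 c2 F tau0).
Local Notation input F := (dpc_input delta r1 al off F).
Local Notation sigma := (@common_state R m M1 M2 tau).

Definition codeword_in (A : {set grid}) (s : 'I_m -> R) : option grid :=
  [pick g in ball (center al off s) r1 | g \in A].

Lemma codewordE f c s : codeword delta r1 al off f c s =
  codeword_in [set g | f g == (c, ord0)]%SET s.
Proof. by apply: eq_pick => g; rewrite !inE. Qed.

(** The decoding ball as a function of the codeword set [A] alone. The colours of the points outside
    [A] do not enter, which is what [card_collision] requires. *)
Definition received_ball (s z : 'I_m -> R) (A : {set grid}) : {set grid} :=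
  let x i :=
    if codeword_in A s is Some g then delta * (g i)%:R - center al off s i else 0 in
  ball (center al off (fun i => x i + s i + z i)) r2.

(** The sent point leaves the decoding ball: its difference to the center of that ball is
    [(1 - al) * x - al * z], where the state has cancelled. *)
Definition noisy f w := r2 < \sum_i ((1 - al) * input f w.1 (sigma w) i
                                     - al * late (Z w) i) ^+ 2.

(** If a codeword exists and the noise is tame, the sent point is a candidate of the decoder. An
    error then needs another candidate, with the colour of a wrong message. *)
Lemma dpc_decoding_error f w :
  ~~ noisy f w -> dec (scheme f) (Y (scheme f) w) <> (W1 w, W2 w) ->
  [forall g in ball (center al off (sigma w)) r1, f g != (w.1, ord0)] \/
  [exists g in received_ball (sigma w) (late (Z w)) [set g | f g == (w.1, ord0)]%SET,
    f g \in [set c | (c.1 != w.1) && (c.2 == ord0)]%SET].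
Proof.
move=> hn; rewrite dec_dpc_code => herr.
have [hcov|] :=
  boolP [forall g in ball (center al off (sigma w)) r1, f g != (w.1, ord0)].
  by left.
rewrite negb_forall_in => /exists_inP[g1 g1B]; rewrite negbK => fg1; right.
have [g0 g0E] : exists g0, codeword delta r1 al off f w.1 (sigma w) = Some g0.
  rewrite /codeword; case: pickP => [g _|/(_ g1)]; first by exists g.
  by rewrite g1B fg1.
have recE : received_ball (sigma w) (late (Z w)) [set g | f g == (w.1, ord0)]%SET =
    ball (center al off (late (Y (scheme f) w))) r2.
  rewrite /received_ball -codewordE; congr (ball (center al off _) r2).
  by apply/funext => i; rewrite late_Y.
rewrite recE.
have [g0B g0f] : g0 \in ball (center al off (sigma w)) r1 /\ f g0 = (w.1, ord0).
  move: g0E; rewrite /codeword; case: pickP => // g /andP[gB /eqP gf] [<-].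
  by split.
have g0Y : g0 \in ball (center al off (late (Y (scheme f) w))) r2.
  rewrite inE; move: hn; rewrite /noisy -leNgt; congr (_ <= _).
  apply: eq_bigr => i _; congr (_ ^+ 2).
  by rewrite /center late_Y// /dpc_input g0E /center; ring.
move: herr; rewrite /dpc_decoder.
case: pickP => [g /andP[gB gf] herr|/(_ g0)]; last first.
  by rewrite g0Y g0f eqxx.
apply/exists_inP; exists g => //; rewrite inE gf andbT.
by apply/eqP => fgw; apply: herr; rewrite fgw; case: (w) => [[]].
Qed.

Let measurable_message : discrete_measurable (fun w => w.1).
Proof.
have := @discrete_measurable_pair _ sample _ _ (fun w => w.1.1) (fun w => w.1.2).
rewrite (_ : (fun w => (w.1.1, w.1.2)) = fun w => w.1); last by apply/funext => -[[]].
apply; apply: discrete_measurable_ord; exact: measurableT_comp.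
Qed.

Lemma measurable_common_state i : measurable_fun [set: sample] (fun w => sigma w i).
Proof.
have mq (S : sample -> state) : measurable_fun [set: sample] S ->
    measurable_fun [set: sample] (fun w => tau * (quantize tau (S w) i)%:~R).
  move=> mS; apply: measurable_funM => //.
  apply: (@discrete_measurable_fun _ _ _ _ _ (fun w => quantize tau (S w))
    (fun q => (q i)%:~R : R)).
  by apply: discrete_measurable_precomp => //; exact: discrete_measurable_quantize.
apply: measurable_funD; first apply: measurable_funD.
- apply: (measurableT_comp (measurable_late i)).
  by do 3 apply: measurableT_comp => //.
- by apply: mq; do 3 apply: measurableT_comp => //.
- by apply: mq; do 2 apply: measurableT_comp => //.
Qed.

Lemma measurable_common_input f i :
  measurable_fun [set: sample] (fun w => input f w.1 (sigma w) i).
Proof.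
apply: (measurable_fun_discrete (h := fun c w => input f c (sigma w) i)) => //.
by move=> c; apply: measurable_dpc_input => j; exact: measurable_common_state.
Qed.

Lemma measurable_late_Z i : measurable_fun [set: sample] (fun w => late (Z w) i).
Proof. by apply: (measurableT_comp (measurable_late i)); exact: measurableT_comp. Qed.

Lemma measurable_noisy f : measurable [set w | noisy f w].
Proof.
apply: measurable_fun_gt_cst; apply: measurable_sum => i; apply: measurable_funX.
apply: measurable_funB; apply: measurable_funM => //.
  exact: measurable_common_input.
exact: measurable_late_Z.
Qed.

Lemma measurable_decoding_error f :
  measurable [set w | dec (scheme f) (Y (scheme f) w) <> (W1 w, W2 w)].
Proof.
pose D w := dpc_decoder delta r2 al off f (late (Y (scheme f) w)).
have mY i : measurable_fun [set: sample] (fun w => late (Y (scheme f) w) i).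
  under eq_fun do rewrite late_Y//.
  apply: measurable_funD; last exact: measurable_late_Z.
  apply: measurable_funD; last exact: measurable_common_state.
  exact: measurable_common_input.
have mD : discrete_measurable D.
  pose h (B : {set grid}) : message :=
    if [pick g in B | (f g).2 == ord0] is Some g then (f g).1 else (ord0, ord0).
  apply: (@discrete_measurable_comp _ _ _ _ _ h).
  apply: discrete_measurable_grid_ball => i.
  by apply: measurable_funD => //; exact: measurable_funM.
have := discrete_measurable_comp (fun p : message * message => p.1 != p.2)
  (discrete_measurable_pair mD measurable_message).
move=> /(_ true); congr measurable; apply/funext => w; apply/propext.
rewrite /mkset dec_dpc_code -/(D w) (_ : (W1 w, W2 w) = w.1); last by case: (w) => [[]].
by split => /eqP.
Qed.

Section laws.
Variables (Q0 Q1 Q2 N e : R).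
Local Notation law := (channel_law m.+1 M1 M2 Q0 Q1 Q2 N).

Lemma noisy_prob_le f :
  (forall x : 'I_m -> R, \sum_i x i ^+ 2 <= r1 ->
    (iid (gaussian N) m [set z | (r2 < \sum_i ((1 - al) * x i - al * tnth z i) ^+ 2)%R]
       <= e%:E)%E) ->
  (law [set w | noisy f w] <= e%:E)%E.
Proof.
move=> hx.
have mn := measurable_noisy f.
apply: product_le => // c; apply: product_le => [|s].
  exact: measurable_section mn.
have mz : measurable [set z | noisy f (c, (s, z))].
  exact: (measurable_section s (measurable_section c mn)).
(* One unfolding of [iid] separates the noise at time 0 from the late noise. *)
rewrite [X in (X _ <= _)%E]/= /distribution/= /pushforward.
apply: product_le => [|z0].
  by rewrite -[X in measurable X]setTI; exact: measurable_cons_pair.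
(* The input ignores the noise, so zeros may stand in for the late noise. *)
pose x i := input f c (sigma (c, (s, [tuple of z0 :: nseq m 0]))) i.
apply: le_trans (hx x _); last exact: sum_dpc_input_le.
rewrite le_eqVlt; apply/orP; left; apply/eqP; congr (iid (gaussian N) m _).
apply/seteqP; split => z /=; congr (_ < _); apply: eq_bigr => i _;
  by congr ((_ - al * _) ^+ 2); rewrite /late/= tnthS.
Qed.

(** A union bound over [Bad], the noise, and the remaining errors. For each sample outside [Bad],
    the latter concern a fraction of the colourings bounded by covering ([q1]) plus packing ([q2]),
    so some colouring has them with probability at most [q1 + q2]. *)
Lemma random_coding_bound (Bad : set sample) (e' : R) (n1 n2 : nat) :
  (0 < k)%N -> measurable Bad -> (law Bad <= e'%:E)%E ->
  (forall w, ~ Bad w -> n1 <= #|ball (center al off (sigma w)) r1|)%N ->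
  (forall c : 'I_m -> R, #|ball c r2| <= n2)%N ->
  (forall x : 'I_m -> R, \sum_i x i ^+ 2 <= r1 ->
    (iid (gaussian N) m [set z | (r2 < \sum_i ((1 - al) * x i - al * tnth z i) ^+ 2)%R]
       <= e%:E)%E) ->
  exists f, (error_prob (scheme f) law <=
    (e + e' + (#|{: colour}|%:R / (#|{: colour}| + n1)%:R + n2%:R / k%:R))%:E)%E.
Proof.
move=> k0 mBad hBad hcov hpack hnoise.
pose Err f := [set w | dec (scheme f) (Y (scheme f) w) <> (W1 w, W2 w)].
pose A f := Err f `\` Bad `\` [set w | noisy f w].
set q1 := _ / (_ + n1)%:R; set q2 := n2%:R / _.
have q10 : 0 <= q1 by rewrite divr_ge0.
have q20 : 0 <= q2 by rewrite divr_ge0.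
have mErr f : measurable (Err f) by exact: measurable_decoding_error.
have mA f : measurable (A f).
  by apply: measurableD; [apply: measurableD|exact: measurable_noisy].
have [f hf] : exists f, (law (A f) <= (q1 + q2)%:E)%E.
  apply: exists_low_probability => //; first exact: [ffun=> (ord0, ord0, ord0)].
  move=> w.
  have [wBad|/hcov n1B] := pselect (Bad w).
    rewrite big1 ?mulr_ge0 ?addr_ge0// => f _.
    by rewrite indicE memNset// => -[[]].
  pose F1 := [set f : {ffun grid -> colour} |
    [forall g in ball (center al off (sigma w)) r1, f g != (w.1, ord0)]]%SET.
  pose V := [set c : colour | (c.1 != w.1) && (c.2 == ord0)]%SET.
  pose rb := received_ball (sigma w) (late (Z w)).
  pose F2 := [set f : {ffun grid -> colour} |
    [exists g in rb [set g | f g == (w.1, ord0)]%SET, f g \in V]]%SET.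
  have F1le : #|F1|%:R <= q1 * #|{: {ffun grid -> colour}}|%:R.
    rewrite /q1 mulrAC ler_pdivlMr; last first.
      by rewrite ltr0n addn_gt0 card_prod !card_prod !card_ord.
    rewrite -!natrM ler_nat.
    apply: leq_trans (card_avoiding (w.1, ord0) (ball (center al off (sigma w)) r1)).
    by rewrite leq_mul2l leq_add2l n1B orbT.
  have F2le : #|F2|%:R <= q2 * #|{: {ffun grid -> colour}}|%:R.
    rewrite /q2 mulrAC ler_pdivlMr ?ltr0n// -!natrM ler_nat.
    have wV : (w.1, ord0) \notin V by rewrite inE eqxx.
    have := card_collision (c := (w.1, ord0)) (fun B => hpack _ : #|rb B| <= n2)%N wV.
    have M0 : (0 < #|{: message}|)%N by rewrite card_prod !card_ord.
    have VM : (#|V| <= #|{: message}|)%N.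
      rewrite -(card_in_imset (f := fst) (D := V)); first exact: max_card.
      move=> [a1 a2] [b1 b2]; rewrite !inE/= => /andP[_ /eqP->] /andP[_ /eqP->].
      by move=> ->.
    (* At most [#|{: message}|] harmful colours among at least [k] times as many equally frequent
       ones: hence the packing term [n2 / k]. *)
    have kM : (k * #|{: message}| <= #|{: colour}|.-1)%N.
      rewrite [#|{: colour}|]card_prod card_ord mulnS mulnC.
      by case: #|{: message}| M0 => // M _; rewrite addSn/= leq_addl.
    rewrite -/F2 => hF; rewrite -(leq_pmul2r M0) -mulnA.
    apply: leq_trans (leq_mul (leqnn _) kM) _; apply: leq_trans hF _.
    by rewrite mulnC leq_mul.
  apply: (@le_trans _ _ (\sum_f ((f \in F1)%:R + (f \in F2)%:R))).
    apply: ler_sum => f _; rewrite indicE.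
    have [|_] := boolP (w \in A f); last by rewrite addr_ge0.
    rewrite inE => -[[wE _] wN].
    have hN : ~~ noisy f w by apply/negP.
    by case: (dpc_decoding_error hN wE) => h; rewrite !inE h ?lerDl ?lerDr.
  rewrite big_split/= mulrDl lerD//.
    by rewrite -natr_sum -big_mkcond/= sum1_card.
  by rewrite -natr_sum -big_mkcond/= sum1_card.
exists f.
have ErrE : Err f `<=` A f `|` (Bad `|` [set w | noisy f w]).
  move=> w wE; have [wB|wB] := pselect (Bad w); first by right; left.
  have [wN|wN] := pselect (noisy f w); first by right; right.
  by left.
have mN := measurable_noisy f.
rewrite /error_prob (_ : e + e' + _ = (q1 + q2) + (e' + e)); last by ring.
apply: (@le_trans _ _ (law (A f `|` (Bad `|` [set w | noisy f w])))).
  apply: le_measure ErrE; rewrite inE; first exact: mErr.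
  by apply: measurableU => //; exact: measurableU.
rewrite EFinD; apply: le_trans (measureU2 _ _ _) _ => //; first exact: measurableU.
apply: leeD => //; rewrite EFinD.
apply: le_trans (measureU2 _ _ _) _ => //.
by apply: leeD => //; exact: noisy_prob_le.
Qed.

End laws.

End random_coding.

(** * The power constraints, for every sample *)

Section power.
Context {R : realType}.
Variables (m M1 M2 K k : nat) (delta r1 r2 al off tau c1 c2 : R).
Local Notation state := (m.+1.-tuple R).
Local Notation message := ('I_M1.+1 * 'I_M2.+1)%type.
Local Notation sample := (message * (state * state * state * state))%type.
Variable f : {ffun {ffun 'I_m -> 'I_K.+1} -> message * 'I_k.+1}.
Hypothesis tau0 : 0 < tau.
Hypothesis r10 : 0 <= r1.
Local Notation c := (@dpc_code R m M1 M2 K k delta r1 r2 al off tau c1 c2 f tau0).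

(** The weight [t] splits each late square between the scaled input and the residue; the
    announcement fits by itself into the extra share [p] of time 0. *)
Let sum_sqr_le (t p s x0 : R) (x y : 'I_m -> R) :
  0 < t -> 0 <= x0 <= tau -> (forall i, 0 <= y i <= tau) ->
  \sum_i x i ^+ 2 <= r1 ->
  (1 + t) * s ^+ 2 * r1 + (1 + t^-1) * (m%:R * tau ^+ 2) <= m%:R * p ->
  tau ^+ 2 <= p ->
  x0 ^+ 2 + \sum_i (s * x i - y i) ^+ 2 <= m.+1%:R * p.
Proof.
move=> t0 x0t yt hx hp taup.
have sq z : 0 <= z <= tau -> z ^+ 2 <= tau ^+ 2.
  by move=> /andP[z0 zt]; rewrite ler_pXn2r// ?nnegrE// (le_trans z0).
rewrite -natr1 mulrDl mul1r addrC lerD//; last exact: le_trans (sq _ x0t) taup.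
apply: le_trans hp.
apply: (@le_trans _ _ (\sum_i ((1 + t) * (s * x i) ^+ 2 + (1 + t^-1) * tau ^+ 2))).
  apply: ler_sum => i _; apply: le_trans (sqrD_le_weighted _ _ t0) _.
  rewrite lerD2l ler_wpM2l ?sqrrN ?sq//.
  by rewrite addr_ge0// invr_ge0 ltW.
rewrite big_split/= sumr_const card_ord -[X in _ + X]mulr_natl mulrCA lerD2r.
under eq_bigr do rewrite exprMn mulrA.
rewrite -mulr_sumr ler_wpM2l// mulr_ge0 ?sqr_ge0//.
by rewrite addr_ge0// ltW.
Qed.

Let measurable_quantized (S : sample -> state) : measurable_fun [set: sample] S ->
  discrete_measurable (fun w => quantize tau (S w)).
Proof.
move=> mS; apply: discrete_measurable_precomp => //.
exact: discrete_measurable_quantize.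
Qed.

Let split_time n (j : 'I_n.+1) : j = ord0 \/ exists i, j = lift ord0 i.
Proof. by case: (unliftP ord0 j) => [i|] ->; [right; exists i|left]. Qed.

Lemma dpc_power1 (P : probability sample R) (t p : R) : 0 < t ->
  (1 + t) * c1 ^+ 2 * r1 + (1 + t^-1) * (m%:R * tau ^+ 2) <= m%:R * p ->
  tau ^+ 2 <= p -> (power1 c P <= p%:E)%E.
Proof.
move=> t0 hp taup; apply: average_power_le => // [j|w]; last first.
  rewrite big_ord_recl; under eq_bigr do rewrite X1_late.
  rewrite X1_first; apply: sum_sqr_le hp taup => // [|i|].
  - by have /andP[/ltW -> ->] := announce_bound tau0 (W1 w, quantize tau (S1 w)).
  - exact: residue_bound.
  - exact: sum_dpc_input_le.
have mS1 : measurable_fun [set: sample] (@S1 R m.+1 M1 M2).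
  by do 3 apply: measurableT_comp => //.
have [->|[i ->]] := split_time j.
  under eq_fun do rewrite X1_first.
  apply: (@discrete_measurable_fun _ _ _ _ _
    (fun w => (W1 w, quantize tau (S1 w))) (announce tau)).
  apply: discrete_measurable_pair; last exact: measurable_quantized.
  by apply: discrete_measurable_ord; exact: measurableT_comp.
under eq_fun do rewrite X1_late.
apply: measurable_funB; last exact: (measurableT_comp (measurable_residue tau i)).
by apply: measurable_funM => //; exact: measurable_common_input.
Qed.

Lemma dpc_power2 (P : probability sample R) (t p : R) : 0 < t ->
  (1 + t) * c2 ^+ 2 * r1 + (1 + t^-1) * (m%:R * tau ^+ 2) <= m%:R * p ->
  tau ^+ 2 <= p -> (power2 c P <= p%:E)%E.
Proof.
move=> t0 hp taup; apply: average_power_le => // [j|w]; last first.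
  rewrite big_ord_recl; under eq_bigr do rewrite X2_late.
  rewrite X2_first; apply: sum_sqr_le hp taup => // [|i|].
  - by have /andP[/ltW -> ->] := announce_bound tau0 (W2 w, quantize tau (S2 w)).
  - exact: residue_bound.
  - exact: sum_dpc_input_le.
have mS2 : measurable_fun [set: sample] (@S2 R m.+1 M1 M2).
  by do 2 apply: measurableT_comp => //.
have [->|[i ->]] := split_time j.
  under eq_fun do rewrite X2_first.
  apply: (@discrete_measurable_fun _ _ _ _ _
    (fun w => (W2 w, quantize tau (S2 w))) (announce tau)).
  apply: discrete_measurable_pair; last exact: measurable_quantized.
  by apply: discrete_measurable_ord; exact: measurableT_comp.
under eq_fun do rewrite X2_late.
apply: measurable_funB; last exact: (measurableT_comp (measurable_residue tau i)).
by apply: measurable_funM => //; exact: measurable_common_input.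
Qed.

End power.

(** * Choice of the parameters *)

Lemma exists_tail_le d (T : measurableType d) (R : realType) (P : probability T R)
    (V : T -> R) (e : R) :
  measurable_fun [set: T] V -> 0 < e ->
  exists B : nat, (P [set x | (B%:R < V x)%R] <= e%:E)%E.
Proof.
move=> mV e0.
pose F (n : nat) := [set x | n%:R < V x].
have mF n : measurable (F n) by exact: measurable_fun_gt_cst.
have F0 : \bigcap_n F n = set0.
  rewrite -subset0 => x /= /(_ (Num.truncn (V x)).+1 Logic.I) /=; rewrite /F/=.
  by rewrite ltNge ltW// truncnS_gt.
have cF : P (F n) @[n --> \oo] --> P (\bigcap_n F n).
  apply: nonincreasing_cvg_mu => //.
  - by rewrite (le_lt_trans (probability_le1 _ _)) ?ltry.
  - by rewrite F0.
  - move=> n p np; apply/subsetPset => x; rewrite /F/=; apply: le_lt_trans.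
    by rewrite ler_nat.
move: cF; rewrite F0 measure0 => /fine_cvgP[Ffin /cvgrPdist_le /(_ _ e0)].
move=> /(filterI Ffin)[B _ /(_ B (leqnn B))[BF]].
rewrite /= sub0r normrN => h; exists B.
rewrite -(fineK BF) lee_fin; exact: le_trans (ler_norm _) h.
Qed.

(** The terms of the error bound are, in order, the noise, the states too large for the grid,
    covering and packing. Covering uses that the ratio of the counts [n2] and [n1] is at most
    [(b / a) ^ m]. *)
Lemma exists_dpc_code (R : realType) (m M1 M2 k a b : nat)
    (P1 P2 Q0 Q1 Q2 N P D al delta t tau theta c1 c2 lam u eps : R) :
  0 < N -> 0 <= P -> 0 <= D -> 0 < delta -> (0 < a)%N -> (0 < b)%N -> 0 < t ->
  0 < tau -> 0 < theta -> c1 + c2 = 1 -> 0 < lam -> u = 2 * lam * al ^+ 2 * N ->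
  u < 1 -> 0 < eps -> (0 < k)%N ->
  (1 + t) * (a%:R / b%:R) ^+ 2 * D +
    (1 + t^-1) * (delta * (a + b + 1)%:R / b%:R) ^+ 2 <= P ->
  (1 + theta) * c1 ^+ 2 * P + (1 + theta^-1) * tau ^+ 2 <= P1 -> tau ^+ 2 <= P1 ->
  (1 + theta) * c2 ^+ 2 * P + (1 + theta^-1) * tau ^+ 2 <= P2 -> tau ^+ 2 <= P2 ->
  let law := channel_law m.+1 M1 M2 Q0 Q1 Q2 N in
  exists c : Defs.code m.+1 M1 M2,
    [/\ (power1 c law <= P1%:E)%E, (power2 c law <= P2%:E)%E &
      (error_prob c law <=
        (expR (- (m%:R * (lam * (D - ((1 - al) ^+ 2 * P + al ^+ 2 * N) / (1 - u)))))
         + eps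
         + ((M1.+1 * M2.+1 * k.+1)%:R * (b%:R / a%:R) ^+ m + k%:R^-1))%:E)%E].
Proof.
move=> N0 P0 D0 delta0 a0 b0 t0 tau0 theta0 c12 lam0 uE u1 eps0 k0.
move=> hgrid p1 tau1 p2 tau2 law.
pose r1 := m%:R * P; pose r2 := m%:R * D.
have r10 : 0 <= r1 by rewrite mulr_ge0.
have r20 : 0 <= r2 by rewrite mulr_ge0.
(* The grid is finite but the state is unbounded: states with [V w] above [B] are given up, at the
   cost [eps]. *)
pose V w := \sum_i `|al * @common_state R m M1 M2 tau w i|.
have mV : measurable_fun setT V.
  apply: measurable_sum => i; apply: measurableT_comp => //.
  by apply: measurable_funM => //; exact: measurable_common_state.
have [B hB] := exists_tail_le law mV eps0.
(* The margin [r1 + 1] exceeds the radius of the covering ball, because [|y| <= y ^ 2 + 1]. *)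
pose K := (Num.truncn ((B%:R + r1 + 1) / delta)).+1.
have KB : B%:R + r1 + 1 <= delta * K%:R.
  by rewrite mulrC -ler_pdivrMr// ltW// truncnS_gt.
pose off := delta * K%:R.
pose ball := @grid_ball R m (K + K) delta.
(* The largest count over all centers is attained, so that [grid_ball_ratio] can compare it with the
   covering ball around any state. *)
have [n2 [hn2 n20 n2max]] : exists n2, [/\ exists c, #|ball c r2| = n2, (0 < n2)%N
    & forall c, (#|ball c r2| <= n2)%N].
  have hex : exists n, `[< exists c, #|ball c r2| = n >].
    by exists #|ball (fun=> 0) r2|; apply/asboolP; exists (fun=> 0).
  have hub n : `[< exists c, #|ball c r2| = n >] ->
      (n <= #|{: {ffun 'I_m -> 'I_(K + K).+1}}|)%N.
    by move=> /asboolP[c <-]; exact: max_card.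
  case: (ex_maxnP hex hub) => n /asboolP[c cn] hmax.
  have nmax c' : (#|ball c' r2| <= n)%N by apply: hmax; apply/asboolP; exists c'.
  exists n; split=> //; first by exists c.
  apply: leq_trans (nmax (fun=> 0)); apply/card_gt0P.
  exists [ffun=> ord0]; rewrite inE big1// => i _.
  by rewrite ffunE mulr0 subr0 expr0n.
have [n1 hn1 n1min] : exists2 n1, (n2 * a ^ m <= n1 * b ^ m)%N &
    forall n, (n2 * a ^ m <= n * b ^ m)%N -> (n1 <= n)%N.
  have hex : exists n, (n2 * a ^ m <= n * b ^ m)%N.
    by exists (n2 * a ^ m)%N; rewrite leq_pmulr// expn_gt0 b0.
  by case: (ex_minnP hex) => n1 h1 h2; exists n1.
pose Bad := [set w | B%:R < V w].
have hcov w : ~ Bad w ->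
    (n1 <= #|ball (center al off (common_state (M1 := M1) (M2 := M2) tau w)) r1|)%N.
  move=> /negP; rewrite -leNgt => VB; apply: n1min.
  have [c0 <-] := hn2.
  apply: (grid_ball_ratio (t := t)) => //.
    rewrite /r1 /r2 (mulrCA _ m%:R) (mulrCA _ m%:R) -mulrDr.
    by apply: ler_wpM2l.
  move=> i x hx.
  have sV : `|al * common_state (M1 := M1) (M2 := M2) tau w i| <= B%:R.
    by apply: le_trans VB; rewrite /V (bigD1 i)//= lerDl sumr_ge0.
  have : `|x - center al off (common_state (M1 := M1) (M2 := M2) tau w) i| <= r1 + 1.
    apply: le_trans (_ : _ ^+ 2 + 1 <= _); last by rewrite lerD2r; exact: hx.
    by rewrite -real_normK ?num_real//; move: (`|_|) => y; clear; nra.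
  have -> : delta * (K + K)%:R = off + off by rewrite natrD mulrDr.
  move: sV; rewrite /center; move: (al * _) => y.
  rewrite !ler_norml => /andP[+ +] /andP[+ +].
  by move: KB; rewrite -/off; clear => *; apply/andP; split; lra.
have u'0 : 0 < 1 - u by rewrite subr_gt0.
set kappa := lam * _.
have hnoise (x : 'I_m -> R) : \sum_i x i ^+ 2 <= r1 ->
    (iid (gaussian N) m [set z | (r2 < \sum_i ((1 - al) * x i - al * tnth z i) ^+ 2)%R]
      <= (expR (- (m%:R * kappa)))%:E)%E.
  move=> hx; apply: le_trans (chernoff_sqr _ _ N0 lam0 uE u1) _.
  rewrite lee_fin ler_expR; under eq_bigr do rewrite exprMn.
  rewrite -mulr_sumr.
  have : lam / (1 - u) * ((1 - al) ^+ 2 * (\sum_i x i ^+ 2)) <=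
      lam / (1 - u) * ((1 - al) ^+ 2 * r1).
    by apply: ler_wpM2l; [rewrite divr_ge0// ltW|apply: ler_wpM2l; rewrite ?sqr_ge0].
  move=> h; rewrite -lerBrDr -lerBrDl in h *.
  apply: le_trans h _.
  rewrite le_eqVlt; apply/orP; left; apply/eqP.
  rewrite /r1 /r2 /kappa uE; field.
  by rewrite -uE gt_eqF.
have n2k : (0 < n2 * k)%N by rewrite muln_gt0 n20.
have [f hf] := random_coding_bound tau0 c12 r10 n2k (measurable_fun_gt_cst _ mV)
  hB hcov n2max hnoise.
exists (dpc_code delta r1 r2 al off c1 c2 f tau0); split.
- apply: dpc_power1 theta0 _ _ => //.
  rewrite /r1 (mulrCA _ m%:R) (mulrCA _ m%:R) -mulrDr.
  by apply: ler_wpM2l.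
- apply: dpc_power2 theta0 _ _ => //.
  rewrite /r1 (mulrCA _ m%:R) (mulrCA _ m%:R) -mulrDr.
  by apply: ler_wpM2l.
apply: le_trans hf _; rewrite lee_fin lerD2l; apply: lerD.
  rewrite !card_prod !card_ord.
  set C := (_ * _)%N.
  have C0 : (0 < C)%N by rewrite /C !muln_gt0.
  rewrite ler_pdivrMr ?ltr0n ?addn_gt0 ?C0//.
  have hC : (C <= M1.+1 * M2.+1 * k.+1 * n2)%N.
    rewrite /C -(mulnA _ k.+1 n2) leq_mul2l; apply/orP; right.
    by rewrite mulSn (mulnC k) -add1n leq_add2r.
  have hn : n2%:R <= (b%:R / a%:R) ^+ m * n1%:R :> R.
    rewrite expr_div_n mulrAC ler_pdivlMr ?exprn_gt0 ?ltr0n//.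
    by rewrite -!natrX -!natrM ler_nat (mulnC (b ^ m)%N).
  apply: (@le_trans _ _ ((M1.+1 * M2.+1 * k.+1)%:R * n2%:R)).
    by rewrite -natrM ler_nat.
  rewrite -mulrA ler_wpM2l//; apply: le_trans hn _.
  rewrite ler_wpM2l// ?ler_nat ?leq_addl//.
by rewrite natrM invfM mulrA divff ?mul1r// pnatr_eq0 -lt0n.
Qed.

Lemma exists_small_sqr (R : realFieldType) (x y : R) : 0 <= x -> 0 < y ->
  exists2 d, 0 < d & x * d ^+ 2 <= y.
Proof.
move=> x0 y0; have x1 : 0 < x + 1 by lra.
have [h|h] := leP 1 (y / (x + 1)).
  by exists 1 => //; rewrite expr1n mulr1; move: h; rewrite ler_pdivlMr// mul1r; lra.
exists (y / (x + 1)); first by rewrite divr_gt0.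
set d := y / _ in h *; have d0 : 0 < d by rewrite divr_gt0.
have -> : y = d * (x + 1) by rewrite divfK// gt_eqF.
rewrite expr2 mulrCA ler_pM2l//; nra.
Qed.

Lemma exists_weight (R : realFieldType) (x y : R) : 0 < x < y ->
  exists2 t, 0 < t & (1 + t) * x = (x + y) / 2.
Proof.
move=> /andP[x0 xy]; exists ((y - x) / (2 * x)); first by rewrite divr_gt0//; lra.
by field; rewrite gt_eqF.
Qed.

Lemma exists_ratio (R : realType) (x y : R) : 0 < x -> 0 < y -> x ^+ 2 < y ->
  exists a b : nat, [/\ (0 < a)%N, (0 < b)%N, x < a%:R / b%:R & (a%:R / b%:R) ^+ 2 < y].
Proof.
move=> x0 y0 xy.
have : x < Num.sqrt y.
  by rewrite -(@ltr_pXn2r _ 2)// ?nnegrE ?sqr_sqrtr ?sqrtr_ge0// ltW.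
move=> /rat_in_itvoo[q]; rewrite in_itv/= => /andP[xq qy].
have q0 : 0 < q by rewrite -(ltr0q R); exact: lt_trans xq.
have n0 : (0 < numq q)%R by rewrite numq_gt0.
have qE : ratr q = `|numq q|%:R / `|denq q|%:R :> R.
  by rewrite /ratr !natr_absz !gtr0_norm ?denq_gt0.
exists `|numq q|%N, `|denq q|%N; split.
- by rewrite absz_gt0 gt_eqF.
- by rewrite absz_gt0 denq_neq0.
- by rewrite -qE.
- rewrite -qE -(sqr_sqrtr (ltW y0)) ltr_pXn2r// ?nnegrE ?sqrtr_ge0//.
  by rewrite ltW// ltr0q.
Qed.

Lemma exists_contraction (R : realFieldType) (x y : R) : 0 < x < y ->
  exists2 u, 0 < u < 1 & x / (1 - u) < y.
Proof.
move=> /andP[x0 xy]; have y0 : 0 < y by exact: lt_trans xy.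
have xy0 : 0 < x + y by rewrite addr_gt0.
have uE : 1 - (y - x) / (2 * y) = (x + y) / (2 * y) by field; rewrite gt_eqF.
exists ((y - x) / (2 * y)).
  by rewrite divr_gt0 ?subr_gt0 ?mulr_gt0//= -subr_gt0 uE divr_gt0// mulr_gt0.
rewrite uE ltr_pdivrMr ?divr_gt0 ?mulr_gt0//.
rewrite (_ : y * ((x + y) / (2 * y)) = (x + y) / 2); first by lra.
by field; rewrite gt_eqF.
Qed.

(** For [P] near [Pt] and [D] near [P * N / (P + N)], the ratio [P / D] is near [1 + Pt / N], which
    exceeds [rho ^+ 2]. The slack leaves room for a rational [a / b] above [rho], the grid step, the
    residues and Chernoff's exponent. *)
Lemma exists_codes (R : realType) (P1 P2 Q0 Q1 Q2 N rho : R) :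
  0 < P1 -> 0 < P2 -> 0 < N -> 0 < rho ->
  rho ^+ 2 < 1 + (Num.sqrt P1 + Num.sqrt P2) ^+ 2 / N ->
  exists sigma kappa : R, [/\ rho < sigma, 0 < kappa &
    forall m M1 M2 k (eps : R), 0 < eps -> (0 < k)%N ->
    let law := channel_law m.+1 M1 M2 Q0 Q1 Q2 N in
    exists c : Defs.code m.+1 M1 M2,
    [/\ (power1 c law <= P1%:E)%E, (power2 c law <= P2%:E)%E &
      (error_prob c law <= (expR (- (m%:R * kappa)) + eps
         + ((M1.+1 * M2.+1 * k.+1)%:R * sigma^-1 ^+ m + k%:R^-1))%:E)%E]].
Proof.
move=> P10 P20 N0 rho0 hrho.
have s10 : 0 < Num.sqrt P1 by rewrite sqrtr_gt0.
have s20 : 0 < Num.sqrt P2 by rewrite sqrtr_gt0.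
set Pt := (Num.sqrt P1 + Num.sqrt P2) ^+ 2 in hrho.
have Pt0 : 0 < Pt by rewrite exprn_gt0// addr_gt0.
have [P [P0 PPt hP]] : exists P, [/\ 0 < P, P < Pt & rho ^+ 2 * N < P + N].
  have h : rho ^+ 2 * N < Pt + N.
    by move: hrho; rewrite -(ltr_pM2r N0) mulrDl divfK ?gt_eqF// mul1r addrC.
  have [h0|h0] := leP (rho ^+ 2 * N - N) 0.
    by exists (Pt / 2); split; lra.
  by exists ((rho ^+ 2 * N - N + Pt) / 2); split; lra.
have PN0 : 0 < P + N by rewrite addr_gt0.
(* Costa's coefficient: it minimizes [(1 - al) ^+ 2 * P + al ^+ 2 * N], and [D0] is the minimum. *)
pose al := P / (P + N).
have al0 : 0 < al by rewrite divr_gt0.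
pose D0 := P * N / (P + N).
have D00 : 0 < D0 by rewrite divr_gt0// mulr_gt0.
have rho20 : 0 < rho ^+ 2 by rewrite exprn_gt0.
have D0E : (1 - al) ^+ 2 * P + al ^+ 2 * N = D0.
  by rewrite /al /D0; field; rewrite gt_eqF.
(* The interval is nonempty exactly because [rho ^+ 2 * N < P + N]. *)
have [D [D0D hD]] : exists D, D0 < D /\ D < P / rho ^+ 2.
  exists ((D0 + P / rho ^+ 2) / 2).
  suff : D0 < P / rho ^+ 2 by move=> h; split; lra.
  by rewrite /D0 -mulrA ltr_pM2l// ltr_pdivrMr// mulrC ltr_pdivlMr// mulrC.
have D_gt0 : 0 < D by exact: lt_trans D0D.
have [a [b [a0 b0 rab hab]]] : exists a b : nat, [/\ (0 < a)%N, (0 < b)%N,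
    rho < a%:R / b%:R & (a%:R / b%:R) ^+ 2 < P / D].
  apply: exists_ratio => //; first by rewrite divr_gt0.
  by rewrite ltr_pdivlMr// mulrC -ltr_pdivlMr.
have ab0 : 0 < a%:R / b%:R :> R by rewrite divr_gt0// ltr0n.
have [t t0 ht] : exists2 t, 0 < t &
    (1 + t) * ((a%:R / b%:R) ^+ 2 * D) = ((a%:R / b%:R) ^+ 2 * D + P) / 2.
  by apply: exists_weight; rewrite mulr_gt0 ?exprn_gt0//= -ltr_pdivlMr.
have abD : (a%:R / b%:R) ^+ 2 * D < P by rewrite -ltr_pdivlMr.
have ti0 : 0 < 1 + t^-1 by rewrite addr_gt0// invr_gt0.
have [delta delta0 hdelta] : exists2 delta, 0 < delta &
    (1 + t^-1) * ((a + b + 1)%:R / b%:R) ^+ 2 * delta ^+ 2 <=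
    (P - (a%:R / b%:R) ^+ 2 * D) / 2.
  apply: exists_small_sqr; first by rewrite mulr_ge0 ?sqr_ge0// ltW.
  by rewrite divr_gt0// subr_gt0.
have [theta theta0 htheta] : exists2 theta, 0 < theta & (1 + theta) * P = (P + Pt) / 2.
  by apply: exists_weight; rewrite P0.
have thi0 : 0 < 1 + theta^-1 by rewrite addr_gt0// invr_gt0.
have PPt1 : 0 < 1 - P / Pt by rewrite subr_gt0 ltr_pdivrMr// mul1r.
pose Pm := Num.min P1 P2.
have Pm0 : 0 < Pm by rewrite lt_min P10.
have [tau tau0 htau] : exists2 tau, 0 < tau &
    (1 + theta^-1) * tau ^+ 2 <= Pm * (1 - P / Pt) / 2.
  by apply: exists_small_sqr (ltW thi0) _; rewrite divr_gt0// mulr_gt0.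
have [Pm1 Pm2] : Pm <= P1 /\ Pm <= P2 by rewrite /Pm !ge_min !lexx orbT.
(* An encoder of power [p] contributes [p * P / Pt] to the common input. Half of the slack
   [p * (1 - P / Pt)] pays for [theta], the other half for the residue. *)
have tauP (p : R) : 0 < p -> Pm <= p -> [/\ tau ^+ 2 <= p &
    (1 + theta) * (Num.sqrt p / (Num.sqrt P1 + Num.sqrt P2)) ^+ 2 * P +
      (1 + theta^-1) * tau ^+ 2 <= p].
  move=> p0 pm; have q0 : P / Pt < 1 by rewrite ltr_pdivrMr// mul1r.
  have q1 : 0 < P / Pt by rewrite divr_gt0.
  have hp : (1 + theta^-1) * tau ^+ 2 <= p * (1 - P / Pt) / 2.
    by apply: le_trans htau _; rewrite ler_pM2r// ler_pM2r.
  have thi : 0 < theta^-1 by rewrite invr_gt0.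
  split.
    apply: (@le_trans _ _ ((1 + theta^-1) * tau ^+ 2)).
      by rewrite ler_peMl ?sqr_ge0// lerDl ltW.
    apply: le_trans hp _; have := mulr_gt0 p0 q1.
    by move: p0; move: (P / Pt) => y; clear; lra.
  rewrite expr_div_n (sqr_sqrtr (ltW p0)) -/Pt mulrAC htheta.
  rewrite (_ : _ * (p / Pt) = p * (P / Pt + 1) / 2); last by field; rewrite gt_eqF.
  by move: hp; move: (P / Pt) => y; clear; lra.
have [h1 g1] := tauP _ P10 Pm1; have [h2 g2] := tauP _ P20 Pm2.
(* A small [u] keeps the exponent [kappa] positive. *)
have [u /andP[u0 u1] uD] : exists2 u, 0 < u < 1 & D0 / (1 - u) < D.
  by apply: exists_contraction; rewrite D00.
pose lam := u / (2 * al ^+ 2 * N).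
have lam0 : 0 < lam by rewrite divr_gt0// mulr_gt0// mulr_gt0// exprn_gt0.
pose kappa := lam * (D - D0 / (1 - u)).
exists (a%:R / b%:R), kappa; split => //; first by rewrite mulr_gt0// subr_gt0.
move=> m M1 M2 k eps eps0 k0 law; rewrite invf_div /kappa -D0E.
apply: (@exists_dpc_code R m M1 M2 k a b P1 P2 Q0 Q1 Q2 N P D al delta t tau theta
  (Num.sqrt P1 / (Num.sqrt P1 + Num.sqrt P2))
  (Num.sqrt P2 / (Num.sqrt P1 + Num.sqrt P2))
  lam u eps) => //; try exact: ltW.
- by rewrite -mulrDl divff// gt_eqF// addr_gt0.
- by rewrite /lam; field; rewrite !gt_eqF.
- rewrite -mulrA ht.
  have -> : (1 + t^-1) * (delta * (a + b + 1)%:R / b%:R) ^+ 2 =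
    (1 + t^-1) * ((a + b + 1)%:R / b%:R) ^+ 2 * delta ^+ 2.
    by ring.
  by move: hdelta; clear; lra.
Qed.

(** * From single codes to achievable pairs *)

Section achievability.
Context {R : realType}.
Variables (P1 P2 Q0 Q1 Q2 N : R).
Hypotheses (P10 : 0 < P1) (P20 : 0 < P2) (N0 : 0 < N).

Definition respects_power n m1 m2 (c : @Defs.code R n m1 m2) :=
  (power1 c (channel_law n m1 m2 Q0 Q1 Q2 N) <= P1%:E)%E /\
  (power2 c (channel_law n m1 m2 Q0 Q1 Q2 N) <= P2%:E)%E.

Definition zero_code n m1 m2 : @Defs.code R n m1 m2 :=
  Code (fun j => cst 0) (fun j => cst 0) (cst (ord0, ord0)).

Lemma zero_code_respects_power n m1 m2 : (0 < n)%N ->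
  respects_power (zero_code n m1 m2).
Proof.
move=> n0; split; apply: average_power_le => // [j|w].
- by rewrite (_ : (fun w => _) = cst 0)//; apply/funext => w; rewrite tnth_inputs1.
- by rewrite big1 ?mulr_ge0 ?ler0n ?(ltW P10)// => j _; rewrite tnth_inputs1/= expr0n.
- by rewrite (_ : (fun w => _) = cst 0)//; apply/funext => w; rewrite tnth_inputs2.
- by rewrite big1 ?mulr_ge0 ?ler0n ?(ltW P20)// => j _; rewrite tnth_inputs2/= expr0n.
Qed.

Lemma geometric_small (x C e : R) : 0 <= x < 1 -> 0 <= C -> 0 < e ->
  exists n0, forall n, (n0 <= n)%N -> C * x ^+ n <= e.
Proof.
move=> /andP[x0 x1] C0 e0.
have : C * x ^+ n @[n --> \oo] --> C * 0.
  by apply: cvgMr; apply: cvg_expr; rewrite ger0_norm.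
rewrite mulr0 => /cvgrPdist_le/(_ _ e0)[n0 _ hn]; exists n0 => n /hn.
by rewrite sub0r normrN; apply: le_trans; exact: ler_norm.
Qed.

(** Each of the four error terms is made at most [e / 4]. The number of message pairs grows like
    powers of [rho], while covering gains a factor [sigma > rho] per symbol. *)
Lemma exists_low_error_code (r1 r2 e : R) :
  0 <= r1 -> 0 <= r2 -> 0 < e ->
  (2 `^ (r1 + r2)) ^+ 2 < 1 + (Num.sqrt P1 + Num.sqrt P2) ^+ 2 / N ->
  exists n0, forall n, (n0 <= n)%N -> exists c : rate_code n r1 r2,
    respects_power c /\ (error_prob c (channel_law _ _ _ Q0 Q1 Q2 N) <= e%:E)%E.
Proof.
move=> r10 r20 e0 hr; set rho := _ `^ _ in hr.
have rho0 : 0 < rho by rewrite powR_gt0.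
have [sigma [kappa [rs kappa0 hc]]] := exists_codes Q0 Q1 Q2 P10 P20 N0 rho0 hr.
have sigma0 : 0 < sigma by exact: lt_trans rs.
have e4 : 0 < e / 4 by rewrite divr_gt0.
pose k := (Num.truncn (e / 4)^-1).+1.
have hk : k%:R^-1 <= e / 4.
  by rewrite invf_ple ?posrE// ?ltr0n// ltW// truncnS_gt.
have [n1 hn1] : exists n0, forall n, (n0 <= n)%N -> 1 * expR (- kappa) ^+ n <= e / 4.
  by apply: geometric_small => //; rewrite expR_ge0 -expR0 ltr_expR oppr_lt0.
(* The extra factor [rho] comes from time 0: messages are counted at length [n.+1], but only [n]
   symbols carry the code. *)
have [n2 hn2] : exists n0, forall n, (n0 <= n)%N ->
    (rho * k.+1%:R) * (rho / sigma) ^+ n <= e / 4.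
  apply: geometric_small => //; last by rewrite mulr_ge0// ltW.
  by rewrite divr_ge0 ?ltW//= ltr_pdivrMr// mul1r.
exists (maxn n1 n2).+1 => -[//|n]; rewrite ltnS geq_max => /andP[n1n n2n].
have [c [p1 p2 herr]] :=
  hc n (num_messages n.+1 r1).-1 (num_messages n.+1 r2).-1 k _ e4 isT.
exists c; split => //; apply: le_trans herr _; rewrite lee_fin.
rewrite !prednK ?num_messages_gt0//.
have hM (r : R) : (num_messages n.+1 r)%:R <= 2 `^ (n.+1%:R * r) :> R.
  by rewrite truncn_le// powR_ge0.
have := hn1 _ n1n; rewrite mul1r -expRM_natl mulrN => h1.
have h2 : (num_messages n.+1 r1 * num_messages n.+1 r2 * k.+1)%:R * sigma^-1 ^+ n
    <= e / 4.
  apply: le_trans (hn2 _ n2n); rewrite expr_div_n -exprVn mulrA.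
  rewrite ler_wpM2r ?exprn_ge0 ?invr_ge0 ?(ltW sigma0)//.
  rewrite natrM [leRHS]mulrAC ler_wpM2r// -exprS natrM.
  rewrite /rho -powR_mulrn ?powR_ge0// -powRrM (mulrC (r1 + r2)) mulrDr.
  rewrite powRD ?pnatr_eq0 ?implybT//.
  by apply: ler_pM.
lra.
Qed.

(** The threshold length depends on the error level, yet one sequence must serve all levels. At
    length [n], a code is chosen that meets every level [1 / (j + 1)], [j < n], met by some code
    respecting the power constraints. *)
Lemma achievable_of_sum_rate (r : R * R) : 0 <= r.1 -> 0 <= r.2 ->
  (2 `^ (r.1 + r.2)) ^+ 2 < 1 + (Num.sqrt P1 + Num.sqrt P2) ^+ 2 / N ->
  achievable P1 P2 Q0 Q1 Q2 N r.
Proof.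
move=> r10 r20 hr; split=> //; split=> //.
pose err n (c : rate_code n r.1 r.2) := error_prob c (channel_law _ _ _ Q0 Q1 Q2 N).
have hbest n : exists c : rate_code n r.1 r.2, (0 < n)%N ->
    respects_power c /\ forall j, (j < n)%N ->
      (exists c' : rate_code n r.1 r.2,
        respects_power c' /\ (err n c' <= j.+1%:R^-1%:E)%E) ->
      (err n c <= j.+1%:R^-1%:E)%E.
  have [n0|n0] := posnP n; first by exists (zero_code _ _ _); rewrite n0.
  suff h J : exists c : rate_code n r.1 r.2,
    respects_power c /\ forall j, (j < J)%N ->
      (exists c' : rate_code n r.1 r.2,
        respects_power c' /\ (err n c' <= j.+1%:R^-1%:E)%E) ->
      (err n c <= j.+1%:R^-1%:E)%E.
    by have [c hc] := h n; exists c.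
  elim: J => [|J [c [pc hc]]].
    by exists (zero_code _ _ _); split => //; exact: zero_code_respects_power.
  have [[c' [pc' hc']]|no] := pselect (exists c' : rate_code n r.1 r.2,
      respects_power c' /\ (err n c' <= J.+1%:R^-1%:E)%E).
    (* A code that meets level [J] also meets the earlier, weaker ones. *)
    exists c'; split=> // j jJ _; apply: le_trans hc' _.
    by rewrite lee_fin lef_pV2 ?posrE// ler_nat.
  exists c; split=> // j; rewrite ltnS leq_eqVlt => /orP[/eqP ->|]; last exact: hc.
  by move=> /no.
pose c n := sval (cid (hbest n)).
have hc n : (0 < n)%N -> _ := svalP (cid (hbest n)).
exists c; split; first by move=> n n0; have [[]] := hc n n0.
have small e : 0 < e -> \forall n \near \oo, (err n (c n) <= e%:E)%E.
  move=> e0; pose j := Num.truncn e^-1.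
  have j0 : 0 < j.+1%:R^-1 :> R by [].
  have [n0 hn0] := exists_low_error_code r10 r20 j0 hr.
  exists (maxn n0 j.+1) => // n /=; rewrite geq_max => /andP[n0n jn].
  have [_ /(_ _ jn (hn0 _ n0n)) h] := hc n (leq_ltn_trans (leq0n _) jn).
  apply: le_trans h _; rewrite lee_fin invf_ple ?posrE//.
  by rewrite ltW// truncnS_gt.
have err_ge0 n : (0 <= err n (c n))%E by exact: measure_ge0.
apply/fine_cvgP; split.
  apply: filterS (small _ ltr01) => n h.
  by rewrite ge0_fin_numE ?err_ge0// (le_lt_trans h) ?ltry.
apply/cvgrPdist_le => e e0; apply: filterS (small _ e0) => n h.
have fn : err n (c n) \is a fin_num.
  by rewrite ge0_fin_numE ?err_ge0// (le_lt_trans h) ?ltry.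
rewrite /= sub0r normrN ger0_norm ?fine_ge0 -?lee_fin ?fineK//; exact: err_ge0.
Qed.

End achievability.

(** * Comparison with the claimed bound *)

(** Dropping the residual states [q1] and [q2] only raises the three factors; after that, the gap to
    the right-hand side is an explicit nonnegative fraction. *)
Lemma sinr_product_le (R : realFieldType) (a1 a2 A q1 q2 N : R) :
  0 <= a1 -> 0 <= a2 -> 0 <= A -> 0 <= q1 -> 0 <= q2 -> 0 < N ->
  let x := (1 + A / (a1 + a2 + q1 + q2 + N)) * (1 + a1 / (a2 + q2 + N)) *
           (1 + a2 / (a1 + q1 + N)) in
  0 < x /\ x <= 1 + (a1 + a2 + A) / N.
Proof.
move=> a10 a20 A0 q10 q20 N0 x.
have pos y : 0 <= y -> 0 < y + N by move=> y0; exact: ltr_wpDl.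
have frac_gt0 y z : 0 <= y -> 0 <= z -> 0 < 1 + y / (z + N).
  by move=> y0 /pos/ltW z0; rewrite ltr_pwDl// divr_ge0.
have frac_le y z w : 0 <= y -> 0 <= z -> z <= w ->
    1 + y / (w + N) <= 1 + y / (z + N).
  move=> y0 z0 zw; rewrite lerD2l ler_wpM2l// lef_pV2 ?posrE ?pos ?lerD2r//.
  exact: le_trans zw.
have a120 := addr_ge0 a10 a20.
have aq1 := addr_ge0 a10 q10; have aq2 := addr_ge0 a20 q20.
have aq : 0 <= a1 + a2 + q1 + q2 by rewrite !addr_ge0.
split; first by rewrite /x !mulr_gt0// frac_gt0.
apply: (@le_trans _ _
    ((1 + A / (a1 + a2 + N)) * (1 + a1 / (a2 + N)) * (1 + a2 / (a1 + N)))).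
  apply: ler_pM; rewrite ?frac_le ?lerDl//; last 2 first.
  - by apply/ltW/frac_gt0.
  - apply: ler_pM; rewrite ?frac_le ?lerDl//; try exact/ltW/frac_gt0.
    by rewrite -addrA lerDl addr_ge0.
  by apply/ltW/mulr_gt0; exact: frac_gt0.
rewrite -subr_ge0 [X in 0 <= X](_ : _ =
    (a1 + a2 + A + N) * (a1 * a2) / (N * (a1 + N) * (a2 + N))).
  by rewrite divr_ge0 ?mulr_ge0 ?addr_ge0 ?(ltW N0)//.
by field; rewrite !gt_eqF ?pos.
Qed.

Lemma sum_rate_bound_le (R : realType) (P1 P2 Q1 Q2 N alpha1 alpha2 eta1 eta2 : R) :
  0 < P1 -> 0 < P2 -> 0 < N ->
  0 <= alpha1 <= 1 -> 0 <= alpha2 <= 1 -> 0 <= eta1 <= 1 -> 0 <= eta2 <= 1 ->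
  sum_rate_bound P1 P2 Q1 Q2 N alpha1 alpha2 eta1 eta2 <=
  2^-1 * log2 (1 + (Num.sqrt P1 + Num.sqrt P2) ^+ 2 / N).
Proof.
move=> P10 P20 N0 al1 al2 et1 et2.
rewrite /sum_rate_bound ler_pM2l// /log2 ler_pM2r; last first.
  by rewrite invr_gt0 ln_gt0// ltr1n.
set q1 := residual _ _ _; set q2 := residual _ _ _.
have q10 : 0 <= q1 by exact: sqr_ge0.
have q20 : 0 <= q2 by exact: sqr_ge0.
set a1 := (1 - alpha1) * eta1 * P1; set a2 := (1 - alpha2) * eta2 * P2.
pose b1 := alpha1 * eta1 * P1; pose b2 := alpha2 * eta2 * P2.
rewrite -/b1 -/b2.
have [a10 a20 b10 b20] : [/\ 0 <= a1, 0 <= a2, 0 <= b1 & 0 <= b2].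
  by split; rewrite !mulr_ge0 ?(ltW P10) ?(ltW P20) ?subr_ge0//;
    move: al1 al2 et1 et2 => /andP[? ?] /andP[? ?] /andP[? ?] /andP[? ?].
have ab1 : a1 + b1 <= P1.
  by rewrite -mulrDl -mulrDl subrK mul1r ler_piMl//; lra.
have ab2 : a2 + b2 <= P2.
  by rewrite -mulrDl -mulrDl subrK mul1r ler_piMl//; lra.
set A := (Num.sqrt b1 + Num.sqrt b2) ^+ 2.
have A0 : 0 <= A by exact: sqr_ge0.
(* After expanding the squares, [ab1] and [ab2] bound the diagonal terms, and monotonicity of the
   square root bounds the cross term. *)
have hA : a1 + a2 + A <= (Num.sqrt P1 + Num.sqrt P2) ^+ 2.
  rewrite /A !sqrrD !sqr_sqrtr //; try exact: ltW.
  have bP1 : Num.sqrt b1 <= Num.sqrt P1 by rewrite ler_wsqrtr//; lra.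
  have bP2 : Num.sqrt b2 <= Num.sqrt P2 by rewrite ler_wsqrtr//; lra.
  have := ler_pM (sqrtr_ge0 b1) (sqrtr_ge0 b2) bP1 bP2.
  by rewrite !mulr2n; lra.
have [x0 xle] := sinr_product_le a10 a20 A0 q10 q20 N0.
rewrite ler_ln ?posrE ?(lt_le_trans x0 xle)//; last first.
  by rewrite ltr_pwDl// divr_ge0 ?sqr_ge0// ltW.
by apply: le_trans xle _; rewrite lerD2l ler_pM2r// invr_gt0.
Qed.

Theorem theorem3 (R : realType) (P1 P2 Q0 Q1 Q2 N : R)
  (hP1 : 0 < P1) (hP2 : 0 < P2)
  (hQ0 : 0 < Q0) (hQ1 : 0 < Q1) (hQ2 : 0 < Q2) (hN : 0 < N) :
  rate_region P1 P2 Q1 Q2 N `<=` capacity_region P1 P2 Q0 Q1 Q2 N.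
Proof.
move=> r [alpha1 [alpha2 [eta1 [eta2 [[al1 al2 et1 et2] [r10 r20 hr]]]]]].
set x := 1 + (Num.sqrt P1 + Num.sqrt P2) ^+ 2 / N.
have x1 : 1 < x.
  by rewrite /x ltrDl divr_gt0// exprn_gt0// addr_gt0 ?sqrtr_gt0.
have eta_ge0 (Q P eta : R) : 1 - Num.min 1 (Q / P) <= eta <= 1 -> 0 <= eta <= 1.
  move=> /andP[h ->]; rewrite andbT; apply: le_trans h.
  by rewrite subr_ge0 ge_min lexx.
have hsum : r.1 + r.2 <= 2^-1 * log2 x.
  apply: le_trans hr _; apply: sum_rate_bound_le => //; first exact: eta_ge0 et1.
  exact: eta_ge0 et2.
have ln20 : 0 < ln 2 :> R by rewrite ln_gt0// ltr1n.
have C0 : 0 < 2^-1 * log2 x by rewrite mulr_gt0// divr_gt0// ln_gt0.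
(* Scaling by [t < 1] brings the sum rate strictly below the positive bound; letting [t] tend to 1
   then puts [r] in the closure. *)
have hach t : 0 <= t < 1 -> achievable P1 P2 Q0 Q1 Q2 N (t * r.1, t * r.2).
  move=> /andP[t0 t1]; apply: achievable_of_sum_rate => //=; rewrite ?mulr_ge0//.
  have ht : t * r.1 + t * r.2 < 2^-1 * log2 x.
    rewrite -mulrDr; apply: le_lt_trans (_ : t * (2^-1 * log2 x) < _).
      exact: ler_wpM2l.
    by rewrite gtr_pMl.
  rewrite -/x -powR_mulrn ?powR_ge0// -powRrM /powR pnatr_eq0/=.
  rewrite -[ltRHS]lnK ?posrE ?(lt_trans ltr01)// ltr_expR.
  move: ht; rewrite /log2 mulrA ltr_pdivlMr//; lra.
move=> B nB.
have lim (s : R) : t * s @[t --> 1^'-] --> 1 * s.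
  by apply: cvg_at_left_filter; apply: cvgMl; exact: cvg_id.
have hB : \forall t \near 1^'-, B (t * r.1, t * r.2).
  by apply: (cvg_pair (lim r.1) (lim r.2)); rewrite !mul1r; case: (r) nB.
near (1 : R)^'- => t.
exists (t * r.1, t * r.2); split; last by near: t.
apply: hach; apply/andP; split; last by near: t; exact: nbhs_left_lt.
by near: t; apply: nbhs_left_ge.
Unshelve. all: by end_near.
Qed.
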